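(* Let $m=(m_0,m_1,\dots)$ be a bounded sequence of integers with $m_k\ge 2$ for all $k$, let $G_m$ be the associated bounded Vilenkin group, and let $0<p\le 1/2$. Then there exists a martingale $f\in H_p(G_m)$ such that $$\|R^{*}f\|_{p}=+\infty,$$ where $R^{*}$ is the maximal operator of the Riesz logarithmic means.
   Context: Notation: $\mathbb N_+=\{1,2,\dots\}$, $\mathbb N=\mathbb N_+\cup\{0\}$. Let $m=(m_0,m_1,\dots)$ be a sequence of integers $m_k\ge 2$ with $\sup_k m_k<\infty$. Let $Z_{m_k}=\{0,1,\dots,m_k-1\}$ be the additive group of integers modulo $m_k$ with the discrete topology. The (bounded) Vilenkin group $G_m$ is the complete direct product of the groups $Z_{m_k}$, with the product topology; its elements are sequences $x=(x_0,x_1,\dots)$ with $x_k\in Z_{m_k}$. The measure $\mu$ is the product of the measures $\mu_k(\{j\})=1/m_k$ ($j\in Z_{m_k}$), i.e. the Haar measure on $G_m$ with $\mu(G_m)=1$. Put $I_0(x)=G_m$ and $I_n(x)=\{y\in G_m: y_0=x_0,\dots,y_{n-1}=x_{n-1}\}$ for $n\in\mathbb N_+$. Put $M_0=1$, $M_{k+1}=m_kM_k$. Each $n\in\mathbb N$ is written uniquely as $n=\sum_{j\ge 0}n_jM_j$ with $n_j\in Z_{m_j}$, only finitely many $n_j$ nonzero. The generalized Rademacher functions are $r_k(x)=\exp(2\pi i x_k/m_k)$, and the Vilenkin system is $\psi_n(x)=\prod_{k\ge 0}r_k(x)^{n_k}$, $n\in\mathbb N$. For $0<p<\infty$, $\|g\|_p=\left(\int_{G_m}|g|^p\,d\mu\right)^{1/p}$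 is the (quasi)norm of $L_p(G_m)$. Let $\mathcal F_n$ be the $\sigma$-algebra generated by $\{I_n(x):x\in G_m\}$. A martingale $f=(f^{(n)},n\in\mathbb N)$ is a martingale with respect to $(\mathcal F_n)_{n\in\mathbb N}$ and $\mu$. Its maximal function is $f^{*}=\sup_{n\in\mathbb N}|f^{(n)}|$. The martingale Hardy space $H_p(G_m)$ consists of all martingales $f$ with $\|f\|_{H_p}:=\|f^{*}\|_{p}<\infty$. The Vilenkin-Fourier coefficients of a martingale $f$ are $\widehat f(i)=\lim_{k\to\infty}\int_{G_m}f^{(k)}\overline{\psi_i}\,d\mu$. The partial sums are $S_nf=\sum_{k=0}^{n-1}\widehat f(k)\psi_k$ for $n\in\mathbb N_+$, and $S_0f=0$. The Riesz logarithmic means are $R_nf(x)=\frac1{l_n}\sum_{k=1}^{n}\frac{S_kf(x)}{k}$, where $l_n=\sum_{k=1}^{n}\frac1k$ ($n\in\mathbb N_+$), and the maximal operator is $R^{*}f(x)=\sup_{n\in\mathbb N_+}|R_nf(x)|$. *)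

(* Defs.v *)
From HB Require Import structures.
From mathcomp Require Import all_boot all_order all_algebra.
From mathcomp Require Import all_classical all_reals all_analysis.
From mathcomp Require Import complex.

Set Implicit Arguments.
Unset Strict Implicit.
Unset Printing Implicit Defensive.

Import Order.TTheory GRing.Theory Num.Theory.
Import numFieldNormedType.Exports.

Local Open Scope classical_set_scope.
Local Open Scope ring_scope.
Local Open Scope complex_scope.

(* ['Z_n] is the ring of integers modulo [n] only when [1 < n]; the statements
   below assume this of every [m k]. *)
Definition vgroup (m : nat -> nat) : Type :=
  prod_topology (fun k => discrete_topology 'Z_(m k)).

HB.instance Definition _ m := Topological.on (vgroup m).
HB.instance Definition _ m :=
  isPointed.Build (vgroup m) (fun k => (0 : 'Z_(m k))).

(* The Vilenkin group with its Borel sigma-algebra. *)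
Definition vilenkin (m : nat -> nat) : Type :=
  g_sigma_algebraType (@open (vgroup m)).

HB.instance Definition _ m := Measurable.on (vilenkin m).

Definition coord m (x : vilenkin m) (k : nat) : 'Z_(m k) := x k.

(* [mu] is the product of the uniform probabilities on the factors, i.e. the
   normalized Haar measure; it exists by [haar_measure_exists] below. *)
Definition is_product_measure (R : realType) m
    (mu : {measure set (vilenkin m) -> \bar R}) : Prop :=
  forall (n : nat) (A : forall k, {set 'Z_(m k)}),
    mu [set x | forall k, (k < n)%N -> coord x k \in A k] =
    (\prod_(k < n) (#|A k|%:R / (m k)%:R))%:E.

Definition cylinder m (n : nat) (x : vilenkin m) : set (vilenkin m) :=
  [set y | forall k, (k < n)%N -> coord y k = coord x k].

Fixpoint M (m : nat -> nat) (k : nat) : nat :=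
  if k is k'.+1 then (m k' * M m k')%N else 1%N.

(* The coefficient of [M m j] in the mixed-radix expansion of [n]. *)
Definition digit m (n j : nat) : nat := ((n %/ M m j) %% m j)%N.

Definition rademacher (R : realType) m (k : nat) (x : vilenkin m) : R[i] :=
  let t : R := 2 * pi * (nat_of_ord (coord x k))%:R / (m k)%:R in
  cos t +i* sin t.

(* The digits of index [k >= n] of [n] vanish, so the product may stop at [n]:
   see [digit_eq0] and [digit_sum]. *)
Definition psi (R : realType) m (n : nat) (x : vilenkin m) : R[i] :=
  \prod_(k < n) rademacher R k x ^+ digit m n k.

Section Martingale.
Context (R : realType) (m : nat -> nat).
Variable mu : {measure set (vilenkin m) -> \bar R}.
Implicit Types (f : nat -> vilenkin m -> R[i]) (g : vilenkin m -> R[i]).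

Definition cintegrable g : Prop :=
  mu.-integrable setT (fun x => (complex.Re (g x))%:E) /\
  mu.-integrable setT (fun x => (complex.Im (g x))%:E).

Definition cintegral (A : set (vilenkin m)) g : R[i] :=
  (\int[mu]_(x in A) complex.Re (g x)) +i* (\int[mu]_(x in A) complex.Im (g x)).

Definition filtration (n : nat) : set (set (vilenkin m)) :=
  <<s range (@cylinder m n) >>.

Definition adapted_at (n : nat) g : Prop :=
  forall B : set R, measurable B ->
    filtration n ((fun x => complex.Re (g x)) @^-1` B) /\
    filtration n ((fun x => complex.Im (g x)) @^-1` B).

(* The last clause is the defining property of the conditional expectation
   [E(f k | filtration n) = f n]. *)
Definition martingale f : Prop :=
  [/\ forall n, adapted_at n (f n),
      forall n, cintegrable (f n) &
      forall n k, (n <= k)%N -> forall A, filtration n A ->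
        cintegral A (f k) = cintegral A (f n)].

Definition maximal_function f (x : vilenkin m) : \bar R :=
  ereal_sup [set (Normc.normc (f n x))%:E | n in [set: nat]].

Definition in_hardy (p : R) f : Prop :=
  martingale f /\ (Lnorm mu p%:E (maximal_function f) < +oo)%E.

(* [R[i]^o] is [R[i]] with the topology given by the modulus. *)
Definition fourier_coef f (i : nat) : R[i] :=
  lim ((fun k => cintegral setT (fun x => f k x * (psi R i x)^*) : R[i]^o)
         @ \oo).

Definition partial_sum f (n : nat) (x : vilenkin m) : R[i] :=
  \sum_(k < n) fourier_coef f k * psi R k x.

Definition harmonic_sum (n : nat) : R := \sum_(1 <= k < n.+1) k%:R^-1.

Definition riesz_mean f (n : nat) (x : vilenkin m) : R[i] :=
  ((harmonic_sum n)^-1)%:C *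
    \sum_(1 <= k < n.+1) partial_sum f k x / k%:R.

Definition riesz_maximal f (x : vilenkin m) : \bar R :=
  ereal_sup [set (Normc.normc (riesz_mean f n x))%:E |
              n in [set n | (0 < n)%N]].

End Martingale.

Lemma M_gt0 m (hm : forall k, (1 < m k)%N) n : (0 < M m n)%N.
Proof. by elim: n => //= n IH; rewrite muln_gt0 IH (ltnW (hm n)). Qed.

Lemma ltn_M m (hm : forall k, (1 < m k)%N) n : (n < M m n)%N.
Proof.
elim: n => //= n IH; have := hm n; have := leq_mul (hm n) IH.
by rewrite mul2n -addnn => h _; apply: leq_trans h; rewrite addSnnS leq_addl.
Qed.

Lemma digit_eq0 m (hm : forall k, (1 < m k)%N) n k :
  (n <= k)%N -> digit m n k = 0%N.
Proof.
move=> nk; rewrite /digit divn_small ?mod0n//.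
exact: leq_ltn_trans nk (ltn_M hm k).
Qed.

Lemma digit_sum m (hm : forall k, (1 < m k)%N) n :
  n = (\sum_(k < n) digit m n k * M m k)%N.
Proof.
have H k : n = (\sum_(j < k) digit m n j * M m j + n %/ M m k * M m k)%N.
  elim: k => [|k IH]; first by rewrite big_ord0 divn1 muln1.
  rewrite big_ord_recr/= -addnA {1}IH; congr (_ + _)%N.
  rewrite mulnA -mulnDl /digit addnC [X in (X * m k)%N](_ : _ = n %/ M m k %/ m k)%N.
    by rewrite -divn_eq.
  by rewrite -divnMA mulnC.
by rewrite {1}(H n) divn_small ?mul0n ?addn0//; exact: ltn_M.
Qed.

Section Existence.
Context (R : realType) (m : nat -> nat).
Hypothesis hm : forall k, (1 < m k)%N.

(* The digits of [t] in the Cantor expansion with bases [m 0, m 1, ...]; they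
   map Lebesgue measure on [0, 1[ to the product measure. *)
Let phi (t : R) : vilenkin m :=
  fun k => inZp (Num.truncn (t * (M m k.+1)%:R)) : 'Z_(m k).

Let tr n (t : R) := Num.truncn (t * (M m n)%:R).

Let MR_gt0 n : 0 < (M m n)%:R :> R.
Proof. by rewrite ltr0n M_gt0. Qed.

Let trS n t : (tr n.+1 t %/ m n)%N = tr n t.
Proof.
rewrite /tr /=; have m0 : (0 < m n)%N by exact: ltnW.
have [t0|t0] := leP 0 t; last first.
  rewrite !(truncn0Pn _ _) ?div0n// -ltNge (lt_trans _ ltr01)//.
    by rewrite pmulr_llt0.
  by rewrite pmulr_llt0 // (MR_gt0 n.+1).
have h k : 0 <= t * (k%:R) by rewrite mulr_ge0.
apply/esym/truncn_def.
have /andP[h1 h2] := truncn_itv (h (m n * M m n)%N).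
set q := Num.truncn _ in h1 h2 *.
have mR : 0 < (m n)%:R :> R by rewrite ltr0n.
rewrite -(ler_pM2l mR) -(ltr_pM2l mR) mulrCA -!natrM; apply/andP; split.
  by apply: le_trans h1; rewrite ler_nat mulnC leq_divM.
by apply: lt_le_trans h2 _; rewrite ler_nat mulnC ltn_ceil.
Qed.

Fixpoint in_box (A : forall k, {set 'Z_(m k)}) n (j : nat) : bool :=
  if n is n'.+1 then in_box A n' (j %/ m n') && ((inZp j : 'Z_(m n')) \in A n')
  else true.

Let in_boxP (A : forall k, {set 'Z_(m k)}) n t :
  (forall k, (k < n)%N -> coord (phi t) k \in A k) <-> in_box A n (tr n t).
Proof.
elim: n => [|n IH] //=; rewrite trS; split.
  move=> h; apply/andP; split; last exact: (h n).
  by apply/IH => k kn; apply: h; exact: ltnW.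
move=> /andP[/IH h1 h2] k; rewrite ltnS leq_eqVlt => /orP[/eqP ->//|]; exact: h1.
Qed.

Let sum_divmod (a b : nat) (F : nat -> nat) :
  (\sum_(0 <= j < a * b) F j = \sum_(0 <= q < a) \sum_(0 <= r < b) F (q * b + r))%N.
Proof.
elim: a => [|a IH]; first by rewrite mul0n !big_geq.
rewrite mulSnr (@big_cat_nat _ _ _ (a * b)) ?leq_addr//= IH big_nat_recr//=.
congr addn; rewrite -{1}[(a * b)%N]add0n big_addn addKn.
by apply: eq_bigr => r _; rewrite addnC.
Qed.

Let card_box (A : forall k, {set 'Z_(m k)}) n : (\sum_(0 <= j < M m n) in_box A n j = \prod_(k < n) #|A k|)%N.
Proof.
elim: n => [|n IH]; first by rewrite big_ord0 big_nat1.
rewrite big_ord_recr/= -IH mulnC sum_divmod big_distrl/=.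
apply: eq_bigr => q _.
have mE : (Zp_trunc (m n)).+2 = m n by exact: Zp_cast.
rewrite -sum1_card big_distrr/= [RHS]big_mkcond/=.
transitivity (\sum_(0 <= r < (Zp_trunc (m n)).+2)
    in_box A n.+1 (q * m n + r))%N; first by congr (\sum_(r <- index_iota 0 _) _)%N.
rewrite big_mkord; apply: eq_bigr => i _ /=.
have im : (i < m n)%N by rewrite -[X in (_ < X)%N]mE.
rewrite divnMDl ?(ltnW (hm n))// divn_small// addn0.
have -> : inZp (q * m n + i) = i.
  by apply: val_inj => /=; rewrite -[X in (_ * X)%N]mE modnMDl modn_small.
by case: (in_box A n q); case: (i \in A n).
Qed.

Let slice n j : set R := tr n @^-1` [set j].

Let sliceE n j : slice n j `&` `[0, 1[ =
  if (j < M m n)%N then `[j%:R / (M m n)%:R, j.+1%:R / (M m n)%:R[%classic else set0.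
Proof.
apply/seteqP; split => t.
  case=> /= tj; rewrite in_itv/= => /andP[t0 t1].
  have h : 0 <= t * (M m n)%:R by rewrite mulr_ge0.
  have := truncn_itv h; rewrite -/(tr n t) tj => /andP[h1 h2].
  have -> : (j < M m n)%N.
    rewrite -(ltr_nat R); apply: le_lt_trans h1 _.
    by rewrite -[ltRHS]mul1r ltr_pM2r.
  by rewrite /= in_itv/= ler_pdivrMr// ltr_pdivlMr// h1 h2.
case: ifP => // jM /=; rewrite in_itv/= ler_pdivrMr// ltr_pdivlMr// => /andP[h1 h2].
split; first by rewrite /slice/= /tr; apply: truncn_def; rewrite h1.
rewrite /= in_itv/=; apply/andP; split.
  by rewrite -(pmulr_lge0 _ (MR_gt0 n)); exact: le_trans h1.
by rewrite -(ltr_pM2r (MR_gt0 n)) mul1r (lt_le_trans h2)// ler_nat.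
Qed.

Let measurable_slice n j : measurable (slice n j).
Proof.
have -> : slice n j = if j is _.+1 then
    `[j%:R / (M m n)%:R, j.+1%:R / (M m n)%:R[%classic
  else `]-oo, 1%:R / (M m n)%:R[%classic.
  apply/seteqP; split => t.
    rewrite /slice/= => tj; case: j tj => [/eqP|j] tj.
      by rewrite /= in_itv/= ltr_pdivlMr// -truncn_le_nat leqn0.
    have h : 0 <= t * (M m n)%:R.
      apply: le_trans (_ : 1 <= _); rewrite ?ler01// -truncn_gt0.
      by rewrite -/(tr n t) tj.
    have := truncn_itv h; rewrite -/(tr n t) tj.
    by rewrite /= in_itv/= ler_pdivrMr// ltr_pdivlMr//.
  rewrite /slice/=; case: j => [|j] /=; rewrite in_itv/=.
    by rewrite ltr_pdivlMr// -truncn_le_nat leqn0 => /eqP.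
  by rewrite ler_pdivrMr// ltr_pdivlMr// => /truncn_def.
by case: j => [|j]; exact: measurable_itv.
Qed.

Let phi_cyl n s t : tr n s = tr n t -> cylinder n (phi t) (phi s).
Proof.
elim: n => [_ k //|n IH] h k; rewrite ltnS leq_eqVlt => /orP[/eqP ->|].
  by rewrite /coord /phi -/(tr n.+1 s) h.
by apply: IH; rewrite -trS h trS.
Qed.

Let open_cyl (V : set (vgroup m)) x : open V -> V x ->
  exists n, cylinder n x `<=` V.
Proof.
move=> oV Vx; apply: contrapT => /forallNP H.
have /choice[y yH] : forall n, exists y : vgroup m, cylinder n x y /\ ~ V y.
  by move=> n; have := H n; rewrite -existsNE => -[y /not_implyP]; exists y.
have yx : y @ \oo --> (x : vgroup m).
  apply/cvg_sup => i; apply/cvg_image.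
    rewrite eqEsubset; split => // z _ /=.
    by exists (@dfwith _ (fun k => discrete_topology 'Z_(m k)) x i z) => //; rewrite dfwithin.
  move=> W; rewrite /= => Wx.
  have {}Wx : W (x i) by exact: nbhs_singleton Wx.
  exists [set z | W (z i)].
    exists i.+1 => // n /= ni; have := (yH n).1 i ni.
    by rewrite /coord => ->.
  apply/seteqP; split => [_ [z Wz <-]//|z Wz].
  exists (@dfwith _ (fun k => discrete_topology 'Z_(m k)) x i z).
    by rewrite /= dfwithin.
  by rewrite dfwithin.
have : nbhs (x : vgroup m) V by exact: open_nbhs_nbhs.
by move/yx => [n _ /(_ n (leqnn n))]; exact: (yH n).2.
Qed.

Let measurable_phi : measurable_fun [set: R] (phi : R -> vilenkin m).
Proof.
apply: (@measurability _ _ (measurableTypeR R) (vilenkin m) setT phi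
  (@open (vgroup m))) => // _ [V oV <-]; rewrite setTI.
pose J n := [set tr n t | t in [set t | cylinder n (phi t) `<=` V]].
have -> : phi @^-1` V = \bigcup_n \bigcup_(j in J n) slice n j.
  apply/seteqP; split => t /=.
    move=> Vt; have [n nV] := open_cyl oV Vt.
    by exists n => //; exists (tr n t) => //; exists t.
  move=> [n _ [_ [s /= sV <-]]] ts; apply: sV; exact: phi_cyl.
apply: bigcupT_measurable => n; apply: bigcup_measurable => j _.
exact: measurable_slice.
Qed.

Let mI : measurable (`[0, 1[ : set R). Proof. exact: measurable_itv. Qed.

Lemma haar_measure_exists :
  exists mu : {measure set (vilenkin m) -> \bar R}, is_product_measure mu.
Proof.
exists (pushforward (mrestr lebesgue_measure mI) phi) => n A.
rewrite /= /pushforward /mrestr.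
have -> : phi @^-1` [set x | forall k, (k < n)%N -> coord x k \in A k] `&` `[0, 1[
  = \big[setU/set0]_(j < M m n | in_box A n j) (slice n j `&` `[0, 1[).
  rewrite -(bigcup_pred [pred j : 'I__ | in_box A n j]
    (fun j : 'I_(M m n) => slice n j `&` `[0, 1[)).
  apply/seteqP; split => t.
    case=> /in_boxP ht t01.
    have tM : (tr n t < M m n)%N.
      have : (slice n (tr n t) `&` `[0, 1[) t by [].
      by rewrite sliceE; case: ifP.
    by exists (Ordinal tM).
  move=> [j /= hj [tj t01]]; split=> //; apply/in_boxP.
  by move: tj; rewrite /slice/= => ->.
rewrite measure_bigsetU_ord; first last.
- apply/trivIsetP => i j _ _ ij; apply/seteqP; split=> // t [[/= ti _] [tj _]].
  by move/eqP: ij; apply; apply: val_inj; exact: etrans (esym ti) tj.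
- by move=> i; apply: (@measurableI _ (measurableTypeR R)) => //; exact: measurable_slice.
transitivity (\sum_(j < M m n | in_box A n j) ((M m n)%:R^-1)%:E : \bar R)%E.
  apply: eq_bigr => j _; rewrite sliceE ltn_ord.
  rewrite [LHS]lebesgue_measure_itv/= lte_fin.
  by rewrite ltr_pM2r ?invr_gt0// ltr_nat ltnSn -EFinB -mulrBl -natrB// subSnn mul1r.
rewrite sumEFin; congr (_%:E).
transitivity ((\sum_(0 <= j < M m n) in_box A n j)%N%:R / (M m n)%:R : R).
  rewrite big_mkord natr_sum mulr_suml big_mkcond/=; apply: eq_bigr => j _.
  by case: in_box; rewrite ?mul1r ?mul0r.
rewrite card_box natr_prod big_split/= prodfV; congr (_ / _).
by elim: (n) => [|k IH] /=; rewrite ?big_ord0// big_ord_recr/= -IH mulrC natrM.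
Unshelve. exact: measurable_phi.
Qed.

End Existence.

(* Main.v *)
Require Import Defs.
From HB Require Import structures.
From mathcomp Require Import all_boot all_order all_algebra.
From mathcomp Require Import all_classical all_reals all_analysis.
From mathcomp Require Import complex ring lra measurable_realfun.
Import Order.TTheory GRing.Theory Num.Theory.
Import numFieldNormedType.Exports.
Local Open Scope classical_set_scope.
Local Open Scope ring_scope.

Set Implicit Arguments.
Unset Strict Implicit.
Unset Printing Implicit Defensive.

(** The martingale is built from widely separated spectral blocks, on each of
    which all Fourier coefficients are equal.  Write
    [I_s = cylinder s origin] and let [D_(M_n)] be [M_n] times the indicator of
    [I_n], which is the Dirichlet kernel of order [M_n].  For nonnegative
    weights [w_j], the functions
    [f_n = \sum_(j < n) w_j (D_(M_(j+1)) - D_(M_j))] form a martingale whose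
    Fourier coefficients are equal to [w_j] on the whole block
    [M_j <= i < M_(j+1)] (lemma [fourier_coef_block]).

    Upper bound.  The [j]-th difference is supported on [I_j], a set of measure
    [1 / M_j], and is bounded there by [M_(j+1)].  As [p <= 1], the [p]-th power
    is subadditive, so the maximal function has [p]-th power integral at most
    [\sum_j (w_j M_(j+1))^p / M_j] (lemma [in_hardy_block]).

    Lower bound.  Let [x] be in [I_s] with [s < a].  The characters of index
    below [M_s] are equal to 1 at [x], hence [S_(M_a + j) f] grows linearly,
    [S_(M_a + j) f x = S_(M_a) f x + w_a r_a(x) j] for [j <= M_s].  Averaging up
    to [n = M_a + M_s], with logarithmic weights and [l_n = O(a)], gives
    [R* f x >= w_a M_s^2 / (8 B a M_a) - C], where [C] bounds the contribution
    of the blocks below [a] (lemma [riesz_maximal_ge]).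

    Choice of the weights.  All weights vanish except at sparse levels
    [a = alpha_t], where [w_a^p = 2^-t M_a^(1-p)].  The upper bound is then at
    most [\sum_t 2^-t B^p], which is finite.  Because [p <= 1/2], the main term
    of the lower bound has [p]-th power at least [2^-t (16 B a)^-p M_s] on [I_s];
    the exponent [1/2] is the largest one for which
    [M_a^(1-2p) M_s^(2p) >= M_s].  Each of the about [a / 2] scales [a/2 <= s < a] therefore contributes
    the same amount, a constant times [2^-t a^-p], to the integral of [(R* f)^p],
    which is at least a constant times [2^-t a^(1-p)].  Since [alpha_t] may be
    chosen after [t] and after the constant [C] coming from the previous levels,
    this is made larger than [t], and [C] negligible. *)

(** * Cylinders and the functions that depend on finitely many coordinates *)

Section Levels.
Import Defs.
Context (m : nat -> nat).

Lemma cylinder_sym n (x y : vilenkin m) : cylinder n x y -> cylinder n y x.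
Proof. by move=> xy k kn; rewrite xy. Qed.

Lemma cylinder_trans n (y x z : vilenkin m) :
  cylinder n x y -> cylinder n y z -> cylinder n x z.
Proof. by move=> xy yz k kn; rewrite yz// xy. Qed.

Lemma subset_cylinder n k (x : vilenkin m) :
  (n <= k)%N -> cylinder k x `<=` cylinder n x.
Proof. by move=> nk y xy i ni; apply: xy; exact: leq_trans nk. Qed.

Lemma measurable_cylinder n (x : vilenkin m) : measurable (cylinder n x).
Proof.
rewrite (_ : cylinder n x =
  \bigcap_(k in `I_n) (fun y : vilenkin m => coord y k) @^-1` [set coord x k]).
  apply: bigcap_measurableType => k _; apply: sub_sigma_algebra.
  pose K k := discrete_topology 'Z_(m k).
  have [pk _] := @continuousP (vgroup m) _ (@proj nat K k).
  apply: (pk (@proj_continuous nat K k) [set coord x k]).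
  exact: discrete_open.
by [].
Qed.

(** The pointwise form of measurability with respect to the [n]-th sigma-algebra
    of the filtration, which makes sense for values in any type; see
    [filtrationP]. *)
Definition level {T : Type} n (h : vilenkin m -> T) :=
  forall x y, cylinder n x y -> h x = h y.

Lemma levelW {T : Type} n k (h : vilenkin m -> T) :
  (n <= k)%N -> level n h -> level k h.
Proof. by move=> nk hn x y xy; apply: hn; exact: subset_cylinder nk _ xy. Qed.

Definition set_coord n (z : 'Z_(m n)) (x : vilenkin m) : vilenkin m :=
  @dfwith nat (fun k => 'Z_(m k)) x n z.

(** One representative of every cylinder of order [n], listed recursively so
    that sums over cylinders split one coordinate at a time. *)
Fixpoint cells n : seq (vilenkin m) :=
  if n is n'.+1
  then [seq set_coord z x | x <- cells n', z <- index_enum 'Z_(m n')]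
  else [:: (fun=> 0) : vilenkin m].

Lemma coord_set_coord n (z : 'Z_(m n)) x : coord (set_coord z x) n = z.
Proof. exact: dfwith_in. Qed.

Lemma coord_set_coord_neq n (z : 'Z_(m n)) x k :
  k != n -> coord (set_coord z x) k = coord x k.
Proof. by move=> kn; apply: dfwith_out; rewrite eq_sym. Qed.

Lemma cylinder_set_coord n (z : 'Z_(m n)) x : cylinder n x (set_coord z x).
Proof. by move=> k kn; rewrite coord_set_coord_neq// ltn_eqF. Qed.

Lemma cylinderS n (x y : vilenkin m) :
  cylinder n.+1 x y <-> cylinder n x y /\ coord y n = coord x n.
Proof.
split=> [xy|[xy xyn] k]; first by split=> [k kn|]; apply: xy => //; exact: ltnW.
by rewrite ltnS leq_eqVlt => /orP[/eqP->//|]; exact: xy.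
Qed.

Lemma big_cellsS (V : nmodType) n (F : vilenkin m -> V) :
  \sum_(x <- cells n.+1) F x = \sum_(x <- cells n) \sum_z F (@set_coord n z x).
Proof. by rewrite /= big_allpairs_dep. Qed.

Lemma cellsP n (y : vilenkin m) : exists2 x, x \in cells n & cylinder n x y.
Proof.
elim: n => [|n [x xn xy]]; first by exists (fun=> 0); rewrite ?mem_seq1.
exists (set_coord (coord y n) x).
  by apply/allpairsP; exists (x, coord y n); rewrite /= mem_index_enum.
apply/cylinderS; split; last by rewrite coord_set_coord.
apply: cylinder_trans xy; apply: cylinder_sym; exact: cylinder_set_coord.
Qed.

(** Every point lies in exactly one of the cylinders listed by [cells]; the
    induction freezes the last coordinate of [y] in the function [h]. *)
Lemma level_sum_cells (R : pzRingType) n (h : vilenkin m -> R) y : level n h ->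
  \sum_(x <- cells n) h x * \1_(cylinder n x) y = h y.
Proof.
elim: n h => [|n IH] h hn.
  rewrite big_seq1 indicE mem_set// mulr1; exact: hn.
rewrite big_cellsS -(hn (set_coord (coord y n) y)); last first.
  apply/cylinderS; rewrite coord_set_coord; split => //.
  exact/cylinder_sym/cylinder_set_coord.
rewrite -(IH (fun x => h (set_coord (coord y n) x))); last first.
  move=> x x' xx'; apply: hn; apply/cylinderS; rewrite !coord_set_coord; split=> //.
  apply: cylinder_trans (cylinder_set_coord _ _); apply: cylinder_trans xx'.
  exact/cylinder_sym/cylinder_set_coord.
apply: eq_bigr => x _; rewrite (bigD1 (coord y n))//= big1 => [|z zy].
  rewrite addr0; congr (_ * _); rewrite !indicE.
  suff -> : (y \in cylinder n x) =
            (y \in cylinder n.+1 (set_coord (coord y n) x)) by [].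
  apply/idP/idP; rewrite !in_setE cylinderS coord_set_coord.
    move=> xy; split=> //; apply: cylinder_trans xy.
    exact/cylinder_sym/cylinder_set_coord.
  case=> [+ _]; by apply: cylinder_trans; exact: cylinder_set_coord.
rewrite indicE memNset ?mulr0// cylinderS coord_set_coord => -[_ yz].
by rewrite yz eqxx in zy.
Qed.

Lemma filtrationP n (A : set (vilenkin m)) : filtration n A <-> level n A.
Proof.
split=> [|An].
  apply: smallest_sub; last first.
    move=> _ [x _ <-] y z yz; apply/propext; split=> [xy|xz].
      exact: cylinder_trans yz.
    exact: cylinder_trans (cylinder_sym yz).
  split=> [x y _ //|B Bn x y xy|F Fn x y xy].
    by rewrite /setD/= (Bn _ _ xy).
  apply/propext; split=> -[i _ Fi]; exists i => //=.
    by rewrite -(Fn i _ _ xy).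
  by rewrite (Fn i _ _ xy).
have -> : A = \big[setU/set0]_(x <- cells n | `[< A x >]) cylinder n x.
  rewrite -bigcup_seq_cond; apply/seteqP.
  split => [y Ay|y [x /= /andP[_ /asboolP Ax]]].
    have [x xn xy] := cellsP n y; exists x => //=; apply/andP; split=> //.
    by apply/asboolP; rewrite (An _ _ xy).
  by move=> /An <-.
apply: (@bigsetU_measurable _ (g_sigma_algebraType (range (@cylinder m n)))).
by move=> x _; apply: sub_sigma_algebra; exists x.
Qed.

End Levels.

(** * The Vilenkin system *)

Section Psi.
Import Defs.
Local Open Scope complex_scope.
Context (R : realType) (m : nat -> nat).
Hypothesis hm : forall k, (1 < m k)%N.

Lemma M_dvd n k : (n <= k)%N -> (M m n %| M m k)%N.
Proof.
move=> /subnKC <-; elim: (k - n)%N => [|d IH]; first by rewrite addn0.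
by rewrite addnS /=; exact: dvdn_mull.
Qed.

Lemma leq_M n k : (n <= k)%N -> (M m n <= M m k)%N.
Proof. by move=> /M_dvd; apply: dvdn_leq; exact: M_gt0. Qed.

Lemma digit_ge_eq0 n i k : (i < M m n)%N -> (n <= k)%N -> digit m i k = 0%N.
Proof.
move=> iM nk; rewrite /digit divn_small ?mod0n//.
exact: leq_trans iM (leq_M nk).
Qed.

Lemma digit_mod n i k : (k < n)%N -> digit m (i %% M m n) k = digit m i k.
Proof.
move=> kn; rewrite /digit {2}(divn_eq i (M m n)).
have /dvdnP[c ->] : (M m k.+1 %| M m n)%N by exact: M_dvd.
rewrite [M m k.+1]/= mulnA mulnA divnMDl ?M_gt0//.
by rewrite -modnDml mulnA modnMl add0n.
Qed.

Lemma prod_widen (V : comPzRingType) (F : nat -> V) n k : (n <= k)%N ->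
  (forall j, (n <= j)%N -> F j = 1) -> \prod_(j < k) F j = \prod_(j < n) F j.
Proof.
move=> nk F1; rewrite -!(big_mkord xpredT) (@big_cat_nat _ _ _ n 0 k)//=.
by rewrite [X in _ * X]big_nat_cond [X in _ * X]big1 ?mulr1// => j /andP[/andP[/F1]].
Qed.

Lemma psiE n i (x : vilenkin m) : (i < M m n)%N ->
  psi R i x = \prod_(k < n) rademacher R k x ^+ digit m i k.
Proof.
move=> iM; pose F k := @rademacher R m k x ^+ digit m i k.
rewrite /psi -(prod_widen (F := F) (leq_maxl i n)) => [|j ij].
  rewrite (prod_widen (F := F) (leq_maxr i n))// => j nj.
  by rewrite /F (digit_ge_eq0 iM).
by rewrite /F digit_eq0.
Qed.

Lemma level_rademacher k : level k.+1 (@rademacher R m k).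
Proof. by move=> x y xy; rewrite /rademacher xy. Qed.

Lemma level_psi n i : (i < M m n)%N -> level n (@psi R m i).
Proof.
move=> iM x y xy; rewrite !(psiE _ iM); apply: eq_bigr => k _.
congr (_ ^+ _); apply: level_rademacher; exact: subset_cylinder xy.
Qed.

Lemma psi_eq1 n i (x : vilenkin m) :
  (i < M m n)%N -> cylinder n (fun=> 0) x -> psi R i x = 1.
Proof.
move=> iM /(level_psi iM) <-; rewrite /psi big1// => k _.
by rewrite /rademacher /coord /= mulr0 mul0r cos0 sin0 expr1n.
Qed.

(** Splitting off the top digit of the index: the remaining character depends
    on the first [n] coordinates only. *)
Lemma psi_recl n i (x : vilenkin m) : (i < M m n.+1)%N ->
  psi R i x = psi R (i %% M m n) x * rademacher R n x ^+ digit m i n.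
Proof.
move=> iM; rewrite (psiE _ iM) big_ord_recr/=; congr (_ * _).
rewrite (@psiE n) ?ltn_mod ?M_gt0//.
by apply: eq_bigr => k _; rewrite digit_mod.
Qed.

Lemma psi_add n i (x : vilenkin m) : (i < M m n)%N ->
  psi R (M m n + i) x = rademacher R n x * psi R i x.
Proof.
move=> iM; have lt : (M m n + i < M m n.+1)%N.
  apply: (@leq_trans (2 * M m n)); first by rewrite mul2n -addnn ltn_add2l.
  by rewrite leq_mul2r hm orbT.
rewrite (psi_recl _ lt) modnDl modn_small// mulrC; congr (_ * _).
rewrite /digit (_ : (M m n + i) %/ M m n = 1)%N ?modn_small//.
by rewrite -[X in (X + _)%N]mul1n divnMDl ?M_gt0// (divn_small iM).
Qed.

Lemma cis_expr (t : R) n : (cos t +i* sin t) ^+ n = cos (t *+ n) +i* sin (t *+ n).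
Proof.
elim: n => [|n IH]; first by rewrite expr0 mulr0n cos0 sin0.
by rewrite exprS IH mulrS cosD sinD; congr (_ +i* _); rewrite addrC.
Qed.

(** A geometric sum of powers of a nontrivial [m j]-th root of unity. *)
Lemma sum_rademacher j d (x : vilenkin m) : (0 < d < m j)%N ->
  \sum_(z : 'Z_(m j)) rademacher R j (set_coord z x) ^+ d = 0 :> R[i].
Proof.
move=> /andP[d0 dm]; pose u : R := 2 * pi * d%:R / (m j)%:R.
have m0 : (m j)%:R != 0 :> R by rewrite pnatr_eq0 -lt0n ltnW.
have E (z : 'Z_(m j)) : rademacher R j (set_coord z x) ^+ d = (cos u +i* sin u) ^+ z.
  rewrite /rademacher coord_set_coord !cis_expr.
  suff -> : (2 * pi * z%:R / (m j)%:R) *+ d = u *+ z :> R by [].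
  by rewrite -[LHS]mulr_natr -[RHS]mulr_natr /u; field.
rewrite (eq_bigr _ (fun z _ => E z)).
have mE : (Zp_trunc (m j)).+2 = m j by exact: Zp_cast.
rewrite mE.
have : (cos u +i* sin u - 1) * (\sum_(i < m j) (cos u +i* sin u) ^+ i) = 0 :> R[i].
  rewrite -subrX1 cis_expr (_ : u *+ m j = 0 + (pi *+ 2) *+ d).
    by rewrite (periodicn (@cosD2pi R)) (periodicn (@sinD2pi R)) cos0 sin0 subrr.
  by rewrite -mulr_natr /u add0r -[pi *+ 2]mulr_natr -mulr_natr; field.
move/eqP; rewrite mulf_eq0 => /orP[|/eqP//]; rewrite subr_eq0 => /eqP[cu _].
(* [cos u = 1] forces [sin (u / 2) = 0], whereas [0 < u / 2 < pi]. *)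
have uE : u = (u / 2) *+ 2 by rewrite -[RHS]mulr_natr divfK// pnatr_eq0.
have := cos_mulr2n (u / 2); have := cos2sin2 (u / 2); rewrite -uE cu => s2 c2.
have : 0 < sin (u / 2).
  apply: sin_gt0_pi; rewrite /u; apply/andP; split.
    by rewrite !(divr_gt0, mulr_gt0) ?pi_gt0 ?ltr0n// ltnW.
  rewrite ltr_pdivrMr// ltr_pdivrMr ?ltr0n ?(ltnW (hm _))//.
  by rewrite [2 * pi]mulrC ltr_pM2l ?mulr_gt0 ?pi_gt0// ltr_nat.
move=> s0; have : 0 < sin (u / 2) ^+ 2 by rewrite exprn_gt0.
by move: s2 c2; clear; move=> s2 c2 ?; exfalso; lra.
Qed.

End Psi.

(** * Integration over cylinders, and orthogonality *)

Section Integration.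
Import Defs.
Local Open Scope complex_scope.
Context (R : realType) (m : nat -> nat).
Hypothesis hm : forall k, (1 < m k)%N.
Variable mu : {measure set (vilenkin m) -> \bar R}.
Hypothesis mu_product : is_product_measure mu.

Lemma MR_gt0 n : 0 < (M m n)%:R :> R.
Proof. by rewrite ltr0n M_gt0. Qed.

Lemma mu_cylinder n x : mu (cylinder n x) = ((M m n)%:R^-1)%:E.
Proof.
rewrite (_ : cylinder n x =
    [set y | forall k, (k < n)%N -> coord y k \in [set coord x k]%SET]).
  rewrite mu_product; congr (_%:E).
  elim: n => [|n IH]; first by rewrite big_ord0 invr1.
  by rewrite big_ord_recr/= IH cards1 natrM invfM mulrC mul1r.
by apply/seteqP; split => y xy k kn; have := xy k kn; rewrite inE => /eqP.
Qed.

Lemma integrable_cylinder n x :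
  mu.-integrable setT (fun y => (\1_(cylinder n x) y)%:E).
Proof.
have mc := measurable_cylinder n x.
apply/integrableP; split; first exact/measurable_EFinP.
rewrite (eq_integral (fun y => (\1_(cylinder n x) y)%:E)); last first.
  by move=> t _; rewrite gee0_abs// lee_fin.
by rewrite integral_indic// setIT mu_cylinder ltry.
Qed.

Lemma level_expansion n (h : vilenkin m -> R) : level n h ->
  h = fun y => \sum_(x <- cells m n) h x * \1_(cylinder n x) y.
Proof. by move=> hn; apply/funext => y; rewrite level_sum_cells. Qed.

Lemma integrable_level n (h : vilenkin m -> R) : level n h ->
  mu.-integrable setT (EFin \o h).
Proof.
move=> /level_expansion ->; rewrite /comp.
under eq_fun do rewrite -sumEFin.
apply: integrable_sum => // x _.
exact: (@integrableZl _ _ _ mu setT measurableT (h x) _ (integrable_cylinder n x)).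
Qed.

Lemma Rintegral_sum (I : Type) (s : seq I) (F : I -> vilenkin m -> R) :
  (forall i, mu.-integrable setT (EFin \o F i)) ->
  \int[mu]_(y in setT) (\sum_(i <- s) F i y) = \sum_(i <- s) \int[mu]_(y in setT) F i y.
Proof.
move=> iF; elim: s => [|i s IH].
  rewrite big_nil; under eq_Rintegral do rewrite big_nil.
  by rewrite Rintegral_cst// mul0r.
rewrite big_cons -IH; under eq_Rintegral do rewrite big_cons.
rewrite RintegralD//.
rewrite (_ : EFin \o _ = fun y => \sum_(i <- s) (F i y)%:E)%E; last first.
  by apply/funext => y; rewrite /= sumEFin.
by apply: integrable_sum => // k _; exact: iF.
Qed.

(** This turns integrals of cylinder functions into finite sums, so that
    orthogonality and linearity become statements about big operators. *)
Lemma Rintegral_level n (h : vilenkin m -> R) : level n h ->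
  \int[mu]_(y in setT) h y = (M m n)%:R^-1 * \sum_(x <- cells m n) h x.
Proof.
move=> /level_expansion hE; rewrite [in LHS]hE Rintegral_sum => [|x]; last first.
  exact: (@integrableZl _ _ _ mu setT measurableT (h x) _ (integrable_cylinder n x)).
rewrite mulr_sumr; apply: eq_bigr => x _.
rewrite RintegralZl//; last exact: integrable_cylinder.
rewrite /Rintegral integral_indic//; last exact: measurable_cylinder.
by rewrite setIT mu_cylinder/= mulrC.
Qed.

Lemma cintegral_level n (h : vilenkin m -> R[i]) : level n h ->
  cintegral mu setT h = ((M m n)%:R^-1)%:C * \sum_(x <- cells m n) h x.
Proof.
move=> hn; rewrite /cintegral !(@Rintegral_level n); first last.
- by move=> x y /hn ->.
- by move=> x y /hn ->.
elim/big_rec3: _ => [|x a b z _].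
  by rewrite !mulr0.
move: (h x) => [u v].
rewrite !mulrDr => <-.
by rewrite /=; simpc.
Qed.

Lemma M_bracket i : (0 < i)%N -> exists j, (M m j <= i < M m j.+1)%N.
Proof.
move=> i0; case: (ex_minnP (ex_intro (fun j => i < M m j)%N i (ltn_M hm i))).
case=> [|j] ij jmin; first by rewrite ltnNge i0 in ij.
by exists j; rewrite ij andbT leqNgt; apply/negP => /jmin; rewrite ltnn.
Qed.

(** If [M m j <= i < M m j.+1] then [n <= j], so [h] and all factors of [psi i]
    except the power of the [j]-th Rademacher function are constant along the
    [j]-th coordinate; summing over that coordinate first gives zero. *)
Lemma cintegral_psi_eq0 n i (h : vilenkin m -> R[i]) : level n h -> (M m n <= i)%N ->
  cintegral mu setT (fun x => h x * (psi R i x)^* ) = 0.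
Proof.
move=> hn ni; have [j /andP[ji ij]] := M_bracket (leq_trans (M_gt0 hm n) ni).
have nj : (n <= j)%N.
  rewrite leqNgt; apply/negP => /(leq_M hm) /leq_trans/(_ ni).
  by rewrite leqNgt ij.
have hj : level j h by exact: levelW hn.
rewrite (@cintegral_level j.+1); last first.
  move=> x y xy; rewrite (level_psi R hm ij xy) (hj x y)//.
  exact: subset_cylinder xy.
rewrite big_cellsS big1 ?mulr0// => x _.
have d0 : (0 < digit m i j < m j)%N.
  rewrite /digit ltn_mod (ltnW (hm j)) andbT modn_small ?divn_gt0 ?M_gt0//.
  by rewrite ltn_divLR ?M_gt0.
rewrite (eq_bigr (fun z => h x * ((psi R (i %% M m j) x)^* *
    (rademacher R j (set_coord z x) ^+ digit m i j)^* ))) => [|z _].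
  by rewrite -!mulr_sumr -rmorph_sum/= (sum_rademacher R hm _ d0) rmorph0 !mulr0.
have xz := cylinder_set_coord z x.
rewrite (psi_recl R hm _ ij) -(hj _ _ xz) rmorphM/=.
by rewrite -(level_psi R hm _ xz)// ltn_mod M_gt0.
Qed.

End Integration.

(** * Martingales whose differences are multiples of Dirichlet kernel differences *)

Section Lacunary.
Import Defs.
Local Open Scope complex_scope.
Context (R : realType) (m : nat -> nat).
Hypothesis hm : forall k, (1 < m k)%N.
Variable mu : {measure set (vilenkin m) -> \bar R}.
Hypothesis mu_product : is_product_measure mu.

Definition origin : vilenkin m := fun=> 0.

(** The closed form of the Dirichlet kernel of order [M m n], the sum of the
    characters of index below [M m n]. *)
Definition dirichlet n (x : vilenkin m) : R :=
  (M m n)%:R * \1_(cylinder n origin) x.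

Lemma level_indic n (A : set (vilenkin m)) :
  level n A -> level n (\1_A : vilenkin m -> R).
Proof.
move=> An x y xy; rewrite !indicE.
suff -> : (x \in A) = (y \in A) by [].
by apply/idP/idP; rewrite !in_setE (An _ _ xy).
Qed.

Lemma level_dirichlet n : level n (dirichlet n).
Proof.
move=> x y xy; rewrite /dirichlet (_ : \1__ x = \1_(cylinder n origin) y)//.
move: x y xy; apply: level_indic; apply/filtrationP.
by apply: sub_sigma_algebra; exists origin.
Qed.

Lemma mul_dirichlet (V : pzRingType) (c : R -> V) n (h : vilenkin m -> V) x :
  c 0 = 0 -> level n h -> h x * c (dirichlet n x) = h origin * c (dirichlet n x).
Proof.
move=> c0 hn; have [xn|xn] := pselect (cylinder n origin x).
  by rewrite (hn _ _ xn).
by rewrite /dirichlet indicE memNset// mulr0 c0 !mulr0.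
Qed.

(** The reproducing property of the kernel: [h] is constant on the support. *)
Lemma Rintegral_dirichlet n (h : vilenkin m -> R) : level n h ->
  \int[mu]_(x in setT) (h x * dirichlet n x) = h origin.
Proof.
move=> hn.
rewrite (@eq_Rintegral _ _ _ mu setT (fun x => h origin * dirichlet n x)).
  2: by move=> x _; exact: (@mul_dirichlet _ id).
rewrite RintegralZl//; last exact: (integrable_level mu_product (@level_dirichlet n)).
rewrite RintegralZl//; last exact: (integrable_cylinder mu_product).
rewrite /Rintegral integral_indic//; last exact: measurable_cylinder.
by rewrite setIT mu_cylinder//= divff ?mulr1// gt_eqF ?MR_gt0.
Qed.

Lemma cintegral_dirichlet n i :
  cintegral mu setT (fun x => (dirichlet n x)%:C * (psi R i x)^* ) = (i < M m n)%:R.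
Proof.
have [iM|Mi] := ltnP i (M m n); last first.
  apply: (cintegral_psi_eq0 hm mu_product _ Mi).
  by move=> x y /level_dirichlet ->.
rewrite (_ : (fun x => _) = fun x => (dirichlet n x)%:C); last first.
  apply/funext => x; rewrite mulrC.
  rewrite (@mul_dirichlet _ (real_complex R) n (fun x => ((psi R i x)^* )%R))//.
    by rewrite (psi_eq1 _ hm iM)// rmorph1 mul1r.
  by move=> y z /(level_psi R hm iM) ->.
rewrite /cintegral/=.
rewrite (@eq_Rintegral _ _ _ mu setT (fun x => 1 * dirichlet n x)).
  2: by move=> x _; rewrite mul1r.
by rewrite Rintegral_dirichlet// Rintegral_cst// mul0r.
Qed.

Lemma cintegralDZ n (a : R[i]) (g h : vilenkin m -> R[i]) : level n g -> level n h ->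
  cintegral mu setT (fun x => g x + a * h x) =
  cintegral mu setT g + a * cintegral mu setT h.
Proof.
move=> gn hn; rewrite !(cintegral_level mu_product (n := n))//; last first.
  by move=> x y xy; rewrite (gn _ _ xy) (hn _ _ xy).
by rewrite big_split/= -mulr_sumr mulrDr mulrCA.
Qed.

Variable w : nat -> R.

Definition block_sum n (x : vilenkin m) : R :=
  \sum_(j < n) w j * (dirichlet j.+1 x - dirichlet j x).

Definition block_martingale n (x : vilenkin m) : R[i] := (block_sum n x)%:C.

Lemma block_sumS n x :
  block_sum n.+1 x = block_sum n x + w n * (dirichlet n.+1 x - dirichlet n x).
Proof. by rewrite /block_sum big_ord_recr. Qed.

Lemma level_block_sum n : level n (block_sum n).
Proof.
move=> x y xy; apply: eq_bigr => j _.
rewrite (level_dirichlet (subset_cylinder (ltn_ord j) xy)).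
by rewrite (level_dirichlet (subset_cylinder (ltnW (ltn_ord j)) xy)).
Qed.

Lemma level_block_martingale n : level n (block_martingale n).
Proof. by move=> x y xy; rewrite /block_martingale (level_block_sum xy). Qed.

(** Multiplying by the indicator of [A] and applying the reproducing property
    to both kernels of the [k]-th difference gives the value of that indicator
    at [origin] twice, with opposite signs. *)
Lemma Rintegral_block_sum n k A : (n <= k)%N -> level n A ->
  \int[mu]_(x in A) block_sum k x = \int[mu]_(x in A) block_sum n x.
Proof.
move=> nk An; have mA h : \int[mu]_(x in A) h x = \int[mu]_(x in setT) (\1_A x * h x).
  rewrite Rintegral_mkcond; apply: eq_Rintegral => x _.
  by rewrite patchE indicE; case: ifP; rewrite ?mul1r ?mul0r.
elim: k nk => [|k IH]; first by rewrite leqn0 => /eqP->.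
rewrite leq_eqVlt => /orP[/eqP->//|nk]; rewrite -(IH nk) !mA.
have Ak : level k (\1_A : vilenkin m -> R).
  exact: (levelW (ltnSE nk) (level_indic An)).
have Ak1 : level k.+1 (\1_A : vilenkin m -> R) by exact: (levelW (leqnSn k) Ak).
have iD n' j : (n' <= j)%N -> level n' (\1_A : vilenkin m -> R) ->
    mu.-integrable setT (EFin \o (fun x => \1_A x * dirichlet j x)).
  move=> n'j An'; apply: (integrable_level mu_product (n := j)) => x y xy.
  by rewrite (level_dirichlet xy) (levelW n'j An' xy).
rewrite (@eq_Rintegral _ _ _ mu setT (fun x => \1_A x * block_sum k x +
    w k * (\1_A x * dirichlet k.+1 x - \1_A x * dirichlet k x))); last first.
  by move=> x _; rewrite block_sumS; ring.
have iB : mu.-integrable setT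
    (EFin \o (fun x => \1_A x * dirichlet k.+1 x - \1_A x * dirichlet k x)).
  apply: (integrable_level mu_product (n := k.+1)) => x y xy.
  rewrite (level_dirichlet xy) (Ak1 _ _ xy).
  by rewrite (level_dirichlet (subset_cylinder (leqnSn k) xy)).
rewrite RintegralD//.
- rewrite RintegralZl// RintegralB//;
    [|exact: (iD _ _ (leqnn _) Ak1)|exact: (iD _ _ (leqnn _) Ak)].
  by rewrite !Rintegral_dirichlet// subrr mulr0 addr0.
- apply: (integrable_level mu_product (n := k)) => x y xy.
  by rewrite (level_block_sum xy) (Ak _ _ xy).
- exact: (@integrableZl _ _ _ mu setT measurableT (w k) _ iB).
Qed.

Lemma martingale_block : martingale mu block_martingale.
Proof.
split=> [n B _|n|n k nk A /filtrationP An].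
- split; apply/filtrationP => x y xy; rewrite /preimage/= //.
  by rewrite (level_block_sum xy).
- split; first exact: (integrable_level mu_product (@level_block_sum n)).
  exact: (@integrable_level _ _ _ mu_product n (fun=> 0)).
- by rewrite /cintegral/= (Rintegral_block_sum nk An).
Qed.

(** The bracket is the [i]-th Fourier coefficient of the [j]-th difference, that
    is, the indicator of [M m j <= i < M m j.+1]. *)
Lemma cintegral_block_psi k i :
  cintegral mu setT (fun x => block_martingale k x * (psi R i x)^* ) =
  (\sum_(j < k) w j * ((i < M m j.+1)%:R - (i < M m j)%:R))%:C.
Proof.
elim: k => [|k IH].
  rewrite big_ord0 (_ : (fun x => _) = fun=> 0).
    by rewrite /cintegral/= Rintegral_cst// mul0r.
  by apply/funext => x; rewrite /block_martingale /block_sum big_ord0 mul0r.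
(* All functions below depend on the first [N] coordinates, so [cintegralDZ] applies. *)
pose N := maxn i.+1 k.+1.
have lp : level N (fun x : vilenkin m => ((psi R i x)^* )%R).
  move=> x y xy; rewrite (level_psi R hm _ xy)//.
  exact: leq_trans (ltn_M hm i) (leq_M hm (leq_trans (leqnSn i) (leq_maxl _ _))).
have lD j : (j <= k.+1)%N -> level N (fun x => (dirichlet j x)%:C * (psi R i x)^* ).
  move=> jk x y xy; rewrite /= (lp _ _ xy) (_ : dirichlet j x = dirichlet j y)//.
  apply: level_dirichlet; apply: subset_cylinder xy.
  by rewrite (leq_trans jk)// leq_maxr.
rewrite big_ord_recr/= rmorphD/= -IH.
rewrite (_ : (fun x => _) = fun x => (block_martingale k x * (psi R i x)^* +
   (- (w k)%:C) * ((dirichlet k x)%:C * (psi R i x)^* )) +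
   (w k)%:C * ((dirichlet k.+1 x)%:C * (psi R i x)^* )); last first.
  apply/funext => x; rewrite /block_martingale block_sumS rmorphD rmorphM rmorphB/=; ring.
have lm : level N (fun x => block_martingale k x * (psi R i x)^* ).
  move=> x y xy; rewrite /= (lp _ _ xy).
  rewrite (_ : block_martingale k x = block_martingale k y)//.
  apply: level_block_martingale; apply: subset_cylinder xy.
  by rewrite (leq_trans (leqnSn k))// leq_maxr.
have lDk := lD k (leqnSn k); have lDk1 := lD k.+1 (leqnn _).
rewrite (cintegralDZ (n := N))//; last first.
  by move=> x y xy; rewrite (lm _ _ xy) (lDk _ _ xy).
rewrite (cintegralDZ (n := N))// !cintegral_dirichlet.
by rewrite rmorphM rmorphB/= !rmorph_nat; ring.
Qed.

Lemma fourier_coef_eventually i (c : R) :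
  (forall k, (i < k)%N ->
    \sum_(j < k) w j * ((i < M m j.+1)%:R - (i < M m j)%:R) = c) ->
  fourier_coef mu block_martingale i = c%:C.
Proof.
move=> ic; apply: (@lim_near_cst R[i]^o) => //.
exists i.+1 => // k /= ik; by rewrite cintegral_block_psi ic.
Qed.

Lemma fourier_coef0 : fourier_coef mu block_martingale 0 = 0.
Proof.
rewrite (@fourier_coef_eventually _ 0)// => k _; apply: big1 => j _.
by rewrite !M_gt0// subrr mulr0.
Qed.

Lemma fourier_coef_block i j : (M m j <= i < M m j.+1)%N ->
  fourier_coef mu block_martingale i = (w j)%:C.
Proof.
move=> /andP[ji ij]; apply: fourier_coef_eventually => k ik.
have jk : (j < k)%N by apply: ltn_trans ik; apply: leq_trans ji; exact: ltn_M.
have ijF : (i < M m j)%N = false by rewrite ltnNge ji.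
rewrite (bigD1 (Ordinal jk))//= ij ijF subr0 mulr1 big1 ?addr0//.
move=> l; rewrite -val_eqE/= neq_ltn => /orP[lj|jl].
  have li : (M m l.+1 <= i)%N by apply: leq_trans ji; exact: leq_M.
  have li' : (M m l <= i)%N by apply: leq_trans li; exact: leq_M.
  by rewrite !ltnNge li li' subrr mulr0.
have il : (i < M m l)%N by apply: leq_trans ij _; exact: leq_M.
have il' : (i < M m l.+1)%N by apply: leq_trans il _; exact: leq_M.
by rewrite il il' subrr mulr0.
Qed.

End Lacunary.

(** * The Hardy quasinorm *)

(** The integral of an arbitrary nonnegative function is a supremum over the
    simple functions below it, and enlarging the function enlarges that set. *)
Lemma ge0_le_integralT d (T : measurableType d) (R : realType)
    (mu : {measure set T -> \bar R}) (f g : T -> \bar R) :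
  (forall x, (0 <= f x)%E) -> (forall x, (f x <= g x)%E) ->
  (\int[mu]_(x in setT) f x <= \int[mu]_(x in setT) g x)%E.
Proof.
move=> f0 fg; rewrite !ge0_integralTE//; last by move=> x; exact: le_trans (fg x).
apply: ereal_sup_le => _ [h hf <-]; exists h => // x; exact: le_trans (fg x).
Qed.

(** After division by [a + b] both terms lie in the unit interval, where the
    power [p] only increases them. *)
Lemma powR_subadd (R : realType) (p a b : R) : 0 < p -> p <= 1 -> 0 <= a -> 0 <= b ->
  (a + b) `^ p <= a `^ p + b `^ p.
Proof.
move=> p0 p1 a0 b0; have [/eqP|] := eqVneq (a + b) 0.
  rewrite paddr_eq0// => /andP[/eqP-> /eqP->].
  by rewrite addr0 powR0 ?gt_eqF// addr0.
move=> ab; have s0 : 0 < a + b by rewrite lt_def ab addr_ge0.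
have H (c : R) : 0 <= c -> c <= a + b -> c / (a + b) <= c `^ p / (a + b) `^ p.
  move=> c0 cs; have [->|cn] := eqVneq c 0; first by rewrite mul0r divr_ge0// powR_ge0.
  have cp : 0 < c by rewrite lt_def cn.
  rewrite -{2}[c](divfK ab) powRM ?divr_ge0 ?(ltW s0)// ?mulfK ?gt_eqF ?powR_gt0//.
  by apply: ger1_powR => //; rewrite divr_gt0//= ler_pdivrMr// mul1r.
have := lerD (H a a0 _) (H b b0 _); rewrite lerDl b0 lerDr a0 => /(_ isT isT).
rewrite -!mulrDl divff// ler_pdivlMr ?mul1r//; exact: powR_gt0.
Qed.

Lemma powR_sum_le (R : realType) (p : R) (a : nat -> R) n : 0 < p -> p <= 1 ->
  (forall i, 0 <= a i) -> (\sum_(i < n) a i) `^ p <= \sum_(i < n) (a i) `^ p.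
Proof.
move=> p0 p1 a0; elim: n => [|n IH]; first by rewrite !big_ord0 powR0 ?gt_eqF.
rewrite !big_ord_recr/=; apply: le_trans (powR_subadd p0 p1 _ (a0 n)) _.
  exact: sumr_ge0.
by rewrite lerD2r.
Qed.

Section Hardy.
Import Defs.
Local Open Scope complex_scope.
Context (R : realType) (m : nat -> nat).
Hypothesis hm : forall k, (1 < m k)%N.
Variable mu : {measure set (vilenkin m) -> \bar R}.
Hypothesis mu_product : is_product_measure mu.
Variables (w : nat -> R) (p K : R).
Hypotheses (p0 : 0 < p) (p1 : p <= 1) (w0 : forall j, 0 <= w j).

Lemma normc_real (a : R) : Normc.normc (a%:C) = `|a|.
Proof. by rewrite /= expr0n/= addr0 sqrtr_sqr. Qed.

Lemma dirichlet_diff_le j (x : vilenkin m) :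
  `|dirichlet R j.+1 x - dirichlet R j x| <= (M m j.+1)%:R * \1_(cylinder j (origin m)) x.
Proof.
have MM : (M m j)%:R <= (M m j.+1)%:R :> R by rewrite ler_nat leq_M.
rewrite /dirichlet !indicE.
have [xj|xj] := boolP (x \in cylinder j (origin m)); last first.
  rewrite (_ : (x \in _) = false) ?mulr0 ?subrr ?normr0//.
  apply: contraNF xj; rewrite !in_setE; exact: subset_cylinder.
rewrite !mulr1; case: (x \in _).
  by rewrite mulr1 ger0_norm ?subr_ge0// gerBl.
by rewrite mulr0 sub0r normrN ger0_norm.
Qed.

Lemma powR_block_martingale_le n x :
  Normc.normc (block_martingale w n x) `^ p <=
  \sum_(j < n) (w j * (M m j.+1)%:R) `^ p * \1_(cylinder j (origin m)) x.
Proof.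
rewrite normc_real; apply: le_trans (_ : (\sum_(j < n)
    w j * (M m j.+1)%:R * \1_(cylinder j (origin m)) x) `^ p <= _).
  apply: ge0_ler_powR; rewrite ?nnegrE ?(ltW p0)// ?sumr_ge0//.
    by move=> j _; rewrite !mulr_ge0.
  apply: le_trans (ler_norm_sum _ _ _) _; apply: ler_sum => j _.
  by rewrite normrM ger0_norm// -mulrA ler_wpM2l// dirichlet_diff_le.
apply: le_trans (powR_sum_le (a := fun j =>
   w j * (M m j.+1)%:R * \1_(cylinder j (origin m)) x) _ p0 p1 _) _ => [j|].
  by rewrite !mulr_ge0.
apply: ler_sum => j _; rewrite powRM ?mulr_ge0//.
by rewrite indicE; case: (_ \in _); rewrite ?powR1// powR0 ?gt_eqF.
Qed.

Lemma maximal_function_ge0 (x : vilenkin m) :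
  (0 <= maximal_function (block_martingale w) x)%E.
Proof.
apply: (@le_trans _ _ (Normc.normc (block_martingale w 0 x))%:E).
  by rewrite lee_fin normc_real.
by apply: ereal_sup_ubound; exists 0%N.
Qed.

Hypothesis wK : forall n, \sum_(j < n) (w j * (M m j.+1)%:R) `^ p / (M m j)%:R <= K.

(** The [p]-th power of the maximal function is dominated by a series of
    multiples of indicators of cylinders, integrated term by term. *)
Lemma in_hardy_block : in_hardy mu p (block_martingale w).
Proof.
split; first exact: (martingale_block hm mu_product).
rewrite unlock; apply: poweR_lty.
pose c j := (w j * (M m j.+1)%:R) `^ p.
have c0 j : 0 <= c j by exact: powR_ge0.
pose u j (x : vilenkin m) : \bar R := ((c j)%:E * (\1_(cylinder j (origin m)) x)%:E)%E.
have u0 j x : (0 <= u j x)%E by rewrite mule_ge0// lee_fin.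
have mi j : measurable_fun setT (fun x => (\1_(cylinder j (origin m)) x)%:E : \bar R).
  by have /integrableP[] := integrable_cylinder mu_product j (origin m).
have mu_ j : measurable_fun setT (u j).
  by apply: measurable_funeM; exact: mi.
apply: (@le_lt_trans _ _ (\int[mu]_(x in setT) (\sum_(j <oo) u j x))%E); last first.
  rewrite integral_nneseries//.
  apply: (@le_lt_trans _ _ K%:E); last exact: ltry.
  apply: lime_le; first by apply: is_cvg_nneseries => n _ _; exact: integral_ge0.
  apply: nearW => n.
  apply: (@le_trans _ _ (\sum_(j < n) c j / (M m j)%:R)%:E); last by rewrite lee_fin.
  rewrite -sumEFin big_mkord; apply: lee_sum => j _; rewrite ge0_integralZl_EFin//.
  rewrite integral_indic//; last exact: measurable_cylinder.
  by rewrite setIT mu_cylinder.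
apply: ge0_le_integralT => x; first exact: poweR_ge0.
have s0 : (0 <= \sum_(j <oo) u j x)%E by apply: nneseries_ge0.
have pV : (0 <= p^-1)%R by rewrite invr_ge0 ltW.
rewrite gee0_abs; last first.
  by exact: maximal_function_ge0.
have -> : (\sum_(j <oo) u j x = (\sum_(j <oo) u j x) `^ p^-1 `^ p)%E.
  by rewrite -poweRrM mulVf ?gt_eqF// poweRe1.
apply: gt0_ler_poweR; rewrite ?(ltW p0)//.
- by rewrite in_itv/= leey andbT maximal_function_ge0.
- by rewrite in_itv/= leey andbT poweR_ge0.
apply: ge_ereal_sup => _ [n _ <-].
have -> : (Normc.normc (block_martingale w n x))%:E =
    ((Normc.normc (block_martingale w n x)) `^ p `^ p^-1)%:E.
  by rewrite -powRrM mulfV ?gt_eqF// powRr1// normc_real.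
rewrite -poweR_EFin; apply: gt0_ler_poweR => //.
- by rewrite in_itv/= leey andbT lee_fin powR_ge0.
- by rewrite in_itv/= leey andbT s0.
apply: le_trans (nneseries_lim_ge n _) => //.
rewrite big_mkord (eq_bigr (fun j : 'I_n => (c j * \1_(cylinder j (origin m)) x)%:E))//.
by rewrite sumEFin lee_fin powR_block_martingale_le.
Qed.

End Hardy.

(** * Pointwise lower bound for the Riesz maximal function *)

Section Riesz.
Import Defs.
Local Open Scope complex_scope.
Context (R : realType) (m : nat -> nat).
Hypothesis hm : forall k, (1 < m k)%N.
Variable mu : {measure set (vilenkin m) -> \bar R}.
Hypothesis mu_product : is_product_measure mu.
Variables (w : nat -> R).
Hypothesis w0 : forall j, 0 <= w j.
Local Notation normc := Normc.normc.
Local Notation coef := (fourier_coef mu (block_martingale w)).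
Local Notation S := (partial_sum mu (block_martingale w)).

Lemma normc_ge0 (z : R[i]) : 0 <= normc z.
Proof. by case: z => a b; exact: sqrtr_ge0. Qed.

Lemma normc_sum (I : Type) (s : seq I) (F : I -> R[i]) :
  normc (\sum_(i <- s) F i) <= \sum_(i <- s) normc (F i).
Proof.
elim/big_rec2: _ => [|i a b _ ab]; first by rewrite normc_real normr0.
by apply: le_trans (le_normcD _ _) _; rewrite lerD2l.
Qed.

Lemma normc_rademacher k (x : vilenkin m) : normc (rademacher R k x) = 1.
Proof. by rewrite /= cos2Dsin2 sqrtr1. Qed.

Lemma normc_psi i (x : vilenkin m) : normc (psi R i x) = 1.
Proof.
rewrite /psi; elim/big_rec: _ => [|k a _ a1]; first by rewrite Normc.normc1.
rewrite Normc.normcM a1 mulr1; elim: (digit m i k) => [|d IH].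
  by rewrite expr0 Normc.normc1.
by rewrite exprS Normc.normcM normc_rademacher IH mulr1.
Qed.

(** The coefficients are equal to [w j] on a block of length less than
    [M m j.+1]. *)
Lemma sum_normc_coef_le a :
  \sum_(0 <= i < M m a) normc (coef i) <= \sum_(j < a) w j * (M m j.+1)%:R.
Proof.
elim: a => [|a IH].
  by rewrite big_nat1 fourier_coef0// normc_real normr0 big_ord0.
rewrite (@big_cat_nat _ _ _ (M m a))//=; last exact: (leq_M hm (leqnSn a)).
rewrite big_ord_recr/=; apply: lerD => //.
rewrite (eq_big_nat _ _ (F2 := fun=> w a)) => [|i iM]; last first.
  by rewrite (fourier_coef_block hm mu_product w iM) normc_real ger0_norm.
rewrite big_const_nat iter_addr_0 -[leLHS]mulr_natr ler_wpM2l// ler_nat; exact: leq_subr.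
Qed.

Lemma normc_partial_sum_le a n (x : vilenkin m) : (n <= M m a)%N ->
  normc (S n x) <= \sum_(j < a) w j * (M m j.+1)%:R.
Proof.
move=> na; apply: le_trans (sum_normc_coef_le a).
apply: le_trans (normc_sum _ _) _.
rewrite -(big_mkord xpredT (fun i => normc (coef i * psi R i x))).
rewrite [leRHS](@big_cat_nat _ _ _ n)//= -[leLHS]addr0; apply: lerD.
  by apply: ler_sum => i _; rewrite Normc.normcM normc_psi mulr1.
by apply: sumr_ge0 => i _; exact: normc_ge0.
Qed.

Lemma partial_sumS n (x : vilenkin m) : S n.+1 x = S n x + coef n * psi R n x.
Proof. by rewrite /partial_sum big_ord_recr. Qed.

(** The linear growth that makes the Riesz means large: on a cylinder of order
    [s] every character of index below [M m s] is equal to 1, so consecutive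
    terms of the block point in the same direction. *)
Lemma partial_sum_block a s j (x : vilenkin m) :
  (s <= a)%N -> cylinder s (origin m) x -> (j <= M m s)%N ->
  S (M m a + j) x = S (M m a) x + (w a)%:C * rademacher R a x * j%:R.
Proof.
move=> sa xs; elim: j => [_|j IH js]; first by rewrite addn0 mulr0 addr0.
rewrite addnS partial_sumS IH ?(ltnW js)//.
have ja : (j < M m a)%N by exact: leq_trans js (leq_M hm sa).
rewrite (fourier_coef_block hm mu_product w (j := a)); last first.
  rewrite leq_addr/=; apply: (@leq_trans (2 * M m a)).
    by rewrite mul2n -addnn ltn_add2l.
  by rewrite leq_mul2r hm orbT.
by rewrite (psi_add R hm _ ja) (psi_eq1 R hm js xs) mulr1 -natr1; ring.
Qed.

(** A single formula before and inside the block, thanks to the truncated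
    difference. *)
Lemma partial_sum_minn a s k (x : vilenkin m) :
  (s <= a)%N -> cylinder s (origin m) x -> (k <= M m a + M m s)%N ->
  S k x = S (minn k (M m a)) x + (w a)%:C * rademacher R a x * (k - M m a)%:R.
Proof.
move=> sa xs kn; have [ka|/ltnW ak] := leqP k (M m a).
  by rewrite (eqP (_ : k - M m a == 0)%N) ?subn_eq0// mulr0 addr0.
by rewrite -{1}(subnKC ak) (partial_sum_block sa xs)// leq_subLR.
Qed.

(** In the nonzero terms the denominators are at most [2 N], and the numerators
    run from 1 to [t]. *)
Lemma ramp_sum_ge (N t : nat) : (0 < N)%N -> (t <= N)%N ->
  t%:R ^+ 2 / (4 * N%:R) <= \sum_(1 <= k < (N + t).+1) (k - N)%:R / k%:R :> R.
Proof.
move=> N0; elim: t => [_|t IH tN].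
  by rewrite expr0n mul0r sumr_ge0// => i _; rewrite divr_ge0.
rewrite addnS big_nat_recr//= (_ : (N + t).+1 - N = t.+1)%N; last by rewrite -addnS addKn.
apply: (@le_trans _ _ (t%:R ^+ 2 / (4 * N%:R) + t.+1%:R / (N + t).+1%:R)); last first.
  by rewrite lerD2r IH// ltnW.
rewrite -lerBlDl -mulrBl.
have NR : 0 < N%:R :> R by rewrite ltr0n.
apply: (@le_trans _ _ (t.+1%:R / (2 * N%:R))).
  rewrite ler_pdivrMr ?mulr_gt0//.
  rewrite (_ : _ * (4 * N%:R) = 2 * t.+1%:R :> R); last by field; rewrite gt_eqF.
  by rewrite -natr1; lra.
rewrite ler_pM2l ?ltr0n// lef_pV2 ?posrE ?mulr_gt0 ?ltr0n ?addnS//.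
by rewrite -natrM ler_nat mul2n -addnn -addnS leq_add2l.
Qed.

Variable B : nat.
Hypothesis mB : forall k, (m k <= B)%N.

(** Each block [M m t <= k < M m t.+1] contributes at most [m t]; this and
    [peak_weight_powR_le] are where boundedness of [m] enters. *)
Lemma harmonic_block_le t : \sum_(1 <= k < M m t) k%:R^-1 <= (B * t)%:R :> R.
Proof.
elim: t => [|t IH]; first by rewrite big_geq.
rewrite (@big_cat_nat _ _ _ (M m t))//=; [|exact: M_gt0|exact: (leq_M hm (leqnSn t))].
rewrite mulnS addnC natrD; apply: lerD => //.
apply: (@le_trans _ _ (\sum_(M m t <= k < m t * M m t) (M m t)%:R^-1)).
  rewrite big_nat [leRHS]big_nat; apply: ler_sum => k /andP[tk _].
  have M0 := M_gt0 hm t.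
  by rewrite lef_pV2 ?posrE ?ltr0n ?(leq_trans M0 tk)// ler_nat.
rewrite big_const_nat iter_addr_0 -[leLHS]mulr_natr mulrC ler_pdivrMr ?MR_gt0//.
rewrite -natrM ler_nat; apply: leq_trans (leq_subr _ _) _.
by rewrite leq_mul2r mB orbT.
Qed.

Lemma harmonic_sum_le a s : (s < a)%N ->
  harmonic_sum R (M m a + M m s) <= 2 * B%:R * a%:R.
Proof.
move=> sa; apply: (@le_trans _ _ (B * a.+1)%:R); last first.
  rewrite -!natrM ler_nat [(2 * B)%N]mulnC -mulnA leq_mul2l mul2n -addnn.
  by rewrite -addn1 leq_add2l (leq_trans _ sa)// orbT.
apply: le_trans (harmonic_block_le a.+1).
have n_lt : (M m a + M m s < M m a.+1)%N.
  apply: (@leq_trans (2 * M m a)); last by rewrite leq_mul2r hm orbT.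
  rewrite mul2n -addnn ltn_add2l; apply: leq_trans (leq_M hm sa).
  by rewrite /= -[X in (X < _)%N]mul1n ltn_mul2r M_gt0//= hm.
rewrite /harmonic_sum [leRHS](@big_cat_nat _ _ _ (M m a + M m s).+1)//=.
by rewrite lerDl sumr_ge0.
Qed.

(** The Riesz mean of order [M m a + M m s] is the sum of an average of partial
    sums of order at most [M m a], bounded by [C], and of a multiple of the ramp
    sum. *)
Lemma riesz_maximal_ge a s C (x : vilenkin m) : (s < a)%N ->
  cylinder s (origin m) x -> \sum_(j < a) w j * (M m j.+1)%:R <= C ->
  ((w a * (M m s)%:R ^+ 2 / (8 * B%:R * a%:R * (M m a)%:R) - C)%:E <=
    riesz_maximal mu (block_martingale w) x)%E.
Proof.
move=> sa xs wC; pose n := (M m a + M m s)%N.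
apply: (@le_trans _ _ (normc (riesz_mean mu (block_martingale w) n x))%:E); last first.
  by apply: ereal_sup_ubound; exists n => //=; rewrite addn_gt0 M_gt0.
have M0 := MR_gt0 R hm a.
pose l := harmonic_sum R n; pose T := \sum_(1 <= k < n.+1) (k - M m a)%:R / k%:R : R.
have l0 : 0 < l.
  rewrite /l /harmonic_sum big_ltn ?ltnS ?addn_gt0 ?M_gt0// invr1.
  by rewrite ltr_pwDl ?sumr_ge0.
pose E := \sum_(1 <= k < n.+1) S (minn k (M m a)) x / k%:R.
have -> : riesz_mean mu (block_martingale w) n x =
    (l^-1)%:C * (E + (w a)%:C * rademacher R a x * T%:C).
  rewrite /riesz_mean -/l; congr (_ * _).
  rewrite rmorph_sum mulr_sumr -big_split/=; apply: eq_big_nat => k /andP[_ kn].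
  by rewrite (partial_sum_minn (ltnW sa) xs)// rmorphM fmorphV !rmorph_nat/=; ring.
have EC : normc E <= C * l.
  rewrite mulr_sumr; apply: le_trans (normc_sum _ _) _; apply: ler_sum => k _.
  rewrite Normc.normcM; apply: ler_pM; rewrite ?normc_ge0//.
    by apply: le_trans wC; apply: normc_partial_sum_le; exact: geq_minr.
  by rewrite Normc.normcV -(rmorph_nat (real_complex R)) normc_real ger0_norm.
have T0 : 0 <= T by apply: sumr_ge0 => k _; rewrite divr_ge0.
have FT : normc ((w a)%:C * rademacher R a x * T%:C) = w a * T.
  by rewrite !Normc.normcM normc_rademacher mulr1 !normc_real !ger0_norm.
have : w a * T <= normc (E + (w a)%:C * rademacher R a x * T%:C) + normc E.
  rewrite -FT -(normcN E); apply: le_trans (le_normcD _ _).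
  by rewrite addrAC subrr add0r.
rewrite lee_fin Normc.normcM normc_real gtr0_norm ?invr_gt0// => wTE.
move: (normc (E + _)) wTE => Z wTZ.
have lB : l <= 2 * B%:R * a%:R by exact: harmonic_sum_le.
have TM : (M m s)%:R ^+ 2 / (4 * (M m a)%:R) <= T.
  by apply: ramp_sum_ge; [exact: M_gt0|exact: (leq_M hm (ltnW sa))].
have B0 : 0 < B%:R :> R by rewrite ltr0n (leq_trans _ (mB 0))// ltnW.
have a0 : 0 < a%:R :> R by rewrite ltr0n (leq_trans _ sa).
have Ba0 : 0 < 2 * B%:R * a%:R :> R by exact: lt_le_trans lB.
rewrite ler_pdivlMl// mulrBr.
have : l * (w a * (M m s)%:R ^+ 2 / (8 * B%:R * a%:R * (M m a)%:R)) <= w a * T.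
  apply: le_trans (_ : w a * ((M m s)%:R ^+ 2 / (4 * (M m a)%:R)) <= _); last first.
    by rewrite ler_wpM2l.
  rewrite (_ : w a * _ / (8 * _ * _ * _) = (w a * ((M m s)%:R ^+ 2 / (4 * (M m a)%:R)))
     / (2 * B%:R * a%:R)); last first.
    by field; rewrite !gt_eqF.
  rewrite mulrA ler_pdivrMr// [l * _]mulrC ler_wpM2l// mulr_ge0// divr_ge0//.
lra.
Qed.

End Riesz.

(** * Choice of the sparse levels *)

Section Lacunarity.
Context (R : realType).

(** Greedy choice of a sparse sequence: the [t]-th level is chosen after the
    accumulated cost of the previous ones is known. *)
Lemma lacunary_choice (P : nat -> R -> nat -> Prop) (G : nat -> nat -> R) :
  (forall t a, 0 <= G t a) ->
  (forall t C l, 0 <= C -> exists2 a, (l <= a)%N & P t C a) ->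
  exists2 alpha : nat -> nat, (forall t, (alpha t < alpha t.+1)%N) &
    forall t, P t (\sum_(i < t) G i (alpha i)) (alpha t).
Proof.
move=> G0 PH.
have /choice[f fP] : forall u : nat * R * nat, exists a : nat,
    0 <= u.1.2 -> (u.2 <= a)%N /\ P u.1.1 u.1.2 a.
  move=> [[t C] l] /=; have [C0|C0] := boolP (0 <= C); last by exists 0%N.
  by have [a la Pa] := PH t C l C0; exists a.
pose fix st t : R * nat :=
  if t is t'.+1 then
    let a := f (t', (st t').1, (st t').2) in ((st t').1 + G t' a, a.+1)
  else (0, 0%N).
pose alpha t := f (t, (st t).1, (st t).2).
have stE t : (st t).1 = \sum_(i < t) G i (alpha i).
  by elim: t => [|t IH]; [rewrite big_ord0 | rewrite big_ord_recr/= -IH].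
have st0 t : 0 <= (st t).1 by rewrite stE sumr_ge0.
exists alpha => t.
  by have [] := fP (t.+1, (st t.+1).1, (st t.+1).2) (st0 t.+1).
by rewrite -stE; have [] := fP (t, (st t).1, (st t).2) (st0 t).
Qed.

Variable alpha : nat -> nat.
Hypothesis alphaS : forall t, (alpha t < alpha t.+1)%N.

Lemma lacunary_lt i j : (i < j)%N -> (alpha i < alpha j)%N.
Proof.
by elim: j => // j IH; rewrite ltnS leq_eqVlt => /orP[/eqP->//|/IH/ltn_trans]; apply.
Qed.

Lemma lacunary_inj : injective alpha.
Proof.
move=> i j; have [/lacunary_lt+ ij|/lacunary_lt+ ij|//] := ltngtP i j.
  by rewrite ij ltnn.
by rewrite ij ltnn.
Qed.

Lemma leq_lacunary t : (t <= alpha t)%N.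
Proof. by elim: t => // t IH; exact: leq_ltn_trans (alphaS t). Qed.

(** The weight [v t] placed at level [alpha t]; the range of the sum is long
    enough because [t <= alpha t]. *)
Definition extend0 (v : nat -> R) (j : nat) : R :=
  \sum_(t < j.+1 | alpha t == j) v t.

Lemma extend0_in v t : extend0 v (alpha t) = v t.
Proof.
have tS : (t < (alpha t).+1)%N by exact: leq_lacunary.
rewrite /extend0 (big_pred1 (Ordinal tS))// => i.
by rewrite /= (inj_eq lacunary_inj).
Qed.

Lemma extend0_out v j : (forall t, alpha t != j) -> extend0 v j = 0.
Proof. by move=> H; rewrite /extend0 big_pred0// => i; exact: negbTE. Qed.

Lemma extend0_ge0 v j : (forall t, 0 <= v t) -> 0 <= extend0 v j.
Proof. by move=> v0; exact: sumr_ge0. Qed.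

Lemma sum_lacunary (G : nat -> R) t :
  (forall j, (forall i, alpha i != j) -> G j = 0) ->
  \sum_(j < alpha t) G j = \sum_(i < t) G (alpha i).
Proof.
have mono i j : (i <= j)%N -> (alpha i <= alpha j)%N.
  by rewrite leq_eqVlt => /orP[/eqP->//|/lacunary_lt/ltnW].
move=> G0; elim: t => [|t IH].
  rewrite big_ord0 big1// => j _; apply: G0 => i; rewrite neq_ltn orbC.
  by rewrite (leq_trans (ltn_ord j)) ?mono.
rewrite big_ord_recr/= -IH -!(big_mkord xpredT).
rewrite (@big_cat_nat _ _ _ (alpha t))//= ?(ltnW (alphaS t))//; congr (_ + _).
rewrite big_ltn// big_nat_cond big1 ?addr0// => j /andP[/andP[tj jt] _].
apply: G0 => i; rewrite neq_ltn; have [/mono it|/mono ti] := leqP i t.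
  by rewrite (leq_ltn_trans it tj).
by rewrite (leq_trans jt ti) orbT.
Qed.

End Lacunarity.

Section Estimates.
Context (R : realType).
Variable p : R.
Hypothesis p_half : p <= 1 / 2.

(** With [N = M m a] and [S = M m s] this bounds below the [p]-th power of the
    main term of the Riesz means; it comes from [S <= N] and [0 <= 1 - 2 p]. *)
Lemma peak_height_ge (lam D N S : R) :
  0 < p -> 0 <= lam -> 0 < D -> 1 <= S -> S <= N ->
  lam / D `^ p * S <= ((lam * N `^ (1 - p)) `^ p^-1 * S ^+ 2 / (D * N)) `^ p.
Proof.
move=> p0 lam0 D0 S1 SN; have S0 : 0 < S by exact: lt_le_trans S1.
have N0 : 0 < N by exact: lt_le_trans SN.
have [DV SV NV] : [/\ 0 <= D, 0 <= S & 0 <= N] by rewrite !ltW.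
have lamN : 0 <= lam * N `^ (1 - p) by rewrite mulr_ge0 ?powR_ge0.
rewrite [leRHS]powRM ?mulr_ge0 ?powR_ge0 ?exprn_ge0 ?invr_ge0 ?mulr_ge0//.
rewrite powRM ?powR_ge0 ?exprn_ge0// -powRrM mulVf ?gt_eqF// powRr1//.
rewrite -[(D * N)^-1]powR_inv1 ?mulr_ge0// powRAC powR_inv1 ?powR_ge0//.
rewrite powRM// invfM.
rewrite (_ : _ * _ * _ * (_ * _) =
  lam / D `^ p * (N `^ (1 - p) / N `^ p * (S ^+ 2) `^ p)); last by ring.
rewrite ler_wpM2l ?divr_ge0 ?powR_ge0// -powRB ?(gt_eqF N0) ?implybT//.
rewrite -powR_mulrn// -powRrM.
apply: (@le_trans _ _ (S `^ (1 - p - p) * S `^ (2 * p))).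
  rewrite -powRD ?(gt_eqF S0) ?implybT//.
  by rewrite (_ : 1 - p - p + 2 * p = 1) ?powRr1//; ring.
rewrite ler_wpM2r ?powR_ge0// ge0_ler_powR ?nnegrE//.
by rewrite -addrA -opprD subr_ge0 -mulr2n -[leLHS]mulr_natr -ler_pdivlMr.
Qed.

(** The lower bound for the integral of the [p]-th power of the maximal function
    over one scale of the [t]-th peak, up to the factor 1/2; the peak sits at
    level [2 * b]. *)
Definition peak_mass (B t b : nat) : R :=
  (2^-1) ^+ t / (16 * B%:R * (2 * b)%:R) `^ p.

Lemma peak_mass_ge0 B t b : 0 <= peak_mass B t b.
Proof. by rewrite divr_ge0 ?powR_ge0 ?exprn_ge0 ?invr_ge0. Qed.

(** With [b = q ^ 2] the mass is at least [2^-t / (32 B q)], because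
    for [p <= 1 / 2] the denominator is at most a square root.  Hence
    both right-hand sides grow at least linearly in [q]. *)
Lemma peak_level_exists (B t l : nat) (C : R) : (0 < B)%N -> 0 <= C ->
  exists b, [/\ (0 < b)%N, (l <= b)%N, C `^ p <= peak_mass B t b * b%:R &
    t%:R <= peak_mass B t b * b%:R / 2].
Proof.
move=> B0 C0; have Cp0 : 0 <= C `^ p by exact: powR_ge0.
pose A : R := 64 * B%:R * 2 ^+ t.
have B1 : 1 <= B%:R :> R by rewrite ler1n.
have A0 : 0 < A by rewrite /A !mulr_gt0 ?exprn_gt0// ltr0n.
pose q := (Num.bound (A * (t%:R + C `^ p)) + l).+1.
have qA : A * (t%:R + C `^ p) <= q%:R.
  apply: ltW; apply: lt_le_trans (archi_boundP _) _.
    by rewrite mulr_ge0 ?addr_ge0// ltW.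
  by rewrite ler_nat; apply: leqW; exact: leq_addr.
exists (q * q)%N.
have q1 : 1 <= q%:R :> R by rewrite ler1n.
have q0 : 0 < q%:R :> R by exact: lt_le_trans q1.
have lq : (l <= q * q)%N.
  by apply: (@leq_trans q); rewrite ?leq_pmulr//; apply: leqW; exact: leq_addl.
rewrite /peak_mass; set D : R := 16 * B%:R * (2 * (q * q))%:R.
have D1 : 1 <= D by rewrite /D -natrM -natrM ler1n !muln_gt0 B0.
have DP : D `^ p <= 32 * B%:R * q%:R.
  apply: (@le_trans _ _ (D `^ 2^-1)); first by rewrite ler_powR// -[leRHS]mul1r.
  rewrite powR12_sqrt ?(le_trans ler01)//.
  rewrite -(ler_pXn2r (n := 2)) ?nnegrE ?sqrtr_ge0//.
  by rewrite sqr_sqrtr ?(le_trans ler01)// /D !natrM; nra.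
have DP0 : 0 < D `^ p by rewrite powR_gt0// (lt_le_trans ltr01).
have key : q%:R / A * 2 <= 2^-1 ^+ t / D `^ p * (q * q)%:R.
  rewrite (_ : _ / A * 2 = 2^-1 ^+ t / (32 * B%:R * q%:R) * (q * q)%:R).
    rewrite ler_wpM2r// ler_wpM2l ?exprn_ge0 ?invr_ge0//.
    by rewrite lef_pV2 ?posrE// (lt_le_trans DP0).
  rewrite /A exprVn natrM; field.
  by rewrite !gt_eqF ?exprn_gt0 ?(lt_le_trans ltr01 B1).
have tC : t%:R + C `^ p <= q%:R / A by rewrite ler_pdivlMr// mulrC.
have t0 : 0 <= t%:R :> R by [].
split=> //.
- by apply: le_trans key; lra.
- by rewrite ler_pdivlMr//; apply: le_trans key; lra.
Qed.

End Estimates.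

(** * Divergence of the integral *)

Section Divergence.
Import Defs.
Local Open Scope complex_scope.
Context (R : realType) (m : nat -> nat).
Hypothesis hm : forall k, (1 < m k)%N.
Variable mu : {measure set (vilenkin m) -> \bar R}.
Hypothesis mu_product : is_product_measure mu.

Lemma sum_M_le n : \sum_(0 <= s < n.+1) (M m s)%:R <= 2 * (M m n)%:R :> R.
Proof.
elim: n => [|n IH]; first by rewrite big_nat1 /= mulr1 ler1n.
rewrite big_nat_recr//=.
have : 2 * (M m n)%:R <= (m n * M m n)%:R :> R by rewrite natrM ler_wpM2r// ler_nat.
lra.
Qed.

(** The numbers [M m s] at least double from one scale to the next, so at a
    given point the sum is at most twice its last nonzero term; this allows adding the scales although the cylinders are
    nested. *)
Lemma sum_cylinder_le (c : R) b d x (y : \bar R) : 0 <= c -> (0 <= y)%E ->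
  (forall s, (b <= s < b + d)%N -> cylinder s (origin m) x ->
    ((c * (M m s)%:R)%:E <= y)%E) ->
  ((\sum_(b <= s < b + d)
      c / 2 * ((M m s)%:R * \1_(cylinder s (origin m)) x))%:E <= y)%E.
Proof.
move=> c0 y0; elim: d => [|d IH] H; first by rewrite addn0 big_geq.
have [xd|xd] := pselect (cylinder (b + d) (origin m) x); last first.
  rewrite addnS big_nat_recr ?leq_addr//= indicE memNset// !mulr0 addr0.
  apply: IH => s /andP[bs sd]; apply: H.
  by rewrite bs addnS ltnW.
apply: le_trans (H (b + d)%N _ xd); last by rewrite leq_addr addnS leqnn.
rewrite lee_fin; apply: (@le_trans _ _ (c / 2 * (2 * (M m (b + d))%:R))); last first.
  by rewrite mulrA divfK.
rewrite -mulr_sumr ler_wpM2l ?divr_ge0//; apply: le_trans (sum_M_le _).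
rewrite addnS [leRHS](@big_cat_nat _ _ _ b)//=; last by rewrite leqW// leq_addr.
rewrite -[leLHS]add0r lerD ?sumr_ge0//; apply: ler_sum => s _.
by rewrite indicE; case: (_ \in _); rewrite ?mulr1 ?mulr0.
Qed.

(** Each of the [d] scales contributes [c / 2], since the cylinder of order [s]
    has measure [(M m s)^-1]. *)
Lemma integral_cylinder_ge (c : R) b d (F : vilenkin m -> \bar R) :
  0 <= c -> (forall x, (0 <= F x)%E) ->
  (forall s x, (b <= s < b + d)%N -> cylinder s (origin m) x ->
     ((c * (M m s)%:R)%:E <= F x)%E) ->
  ((c * d%:R / 2)%:E <= \int[mu]_(x in setT) F x)%E.
Proof.
move=> c0 F0 FM.
pose g s (x : vilenkin m) : R := (M m s)%:R * \1_(cylinder s (origin m)) x.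
have gi s : mu.-integrable setT (EFin \o g s).
  have := integrable_cylinder mu_product s (origin m).
  exact: (@integrableZl _ _ _ mu setT measurableT).
have g0 s x : 0 <= g s x by rewrite mulr_ge0.
have mg s : measurable_fun setT (fun x => (g s x)%:E) by have /integrableP[] := gi s.
have ig s : (\int[mu]_(x in setT) (g s x)%:E = 1)%E.
  under eq_integral do rewrite EFinM.
  have [mi _] := integrableP _ _ _ (integrable_cylinder mu_product s (origin m)).
  rewrite ge0_integralZl_EFin// integral_indic//; last exact: measurable_cylinder.
  by rewrite setIT mu_cylinder// -EFinM divff ?gt_eqF ?MR_gt0.
have <- : (\int[mu]_(x in setT) (\sum_(b <= s < b + d) (c / 2 * g s x)%:E) =
           (c * d%:R / 2)%:E)%E.
  have cg0 s x : (0 <= (c / 2 * g s x)%:E)%E by rewrite lee_fin mulr_ge0// divr_ge0.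
  rewrite ge0_integral_sum// => [|s]; last first.
    exact: (@measurable_funeM _ _ _ setT (fun x => (g s x)%:E) (c / 2)%:E (mg s)).
  rewrite (eq_bigr (fun=> (c / 2)%:E)) => [|s _]; last first.
    under eq_integral do rewrite EFinM.
    rewrite ge0_integralZl_EFin ?divr_ge0// ?ig ?mule1//.
    by move=> x _; rewrite lee_fin.
  rewrite sumEFin big_const_nat addKn iter_addr_0; congr (_%:E).
  by rewrite -mulr_natr; ring.
apply: ge0_le_integralT => x.
  by rewrite sume_ge0// => s _; rewrite lee_fin mulr_ge0// divr_ge0.
rewrite sumEFin; apply: sum_cylinder_le => // s bs xs; exact: FM.
Qed.

End Divergence.

Section Peaks.
Import Defs.
Local Open Scope complex_scope.
Context (R : realType) (m : nat -> nat).
Hypothesis hm : forall k, (1 < m k)%N.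
Variable B : nat.
Hypothesis mB : forall k, (m k <= B)%N.
Variable mu : {measure set (vilenkin m) -> \bar R}.
Hypothesis mu_product : is_product_measure mu.
Variable p : R.
Hypotheses (p0 : 0 < p) (p_half : p <= 1 / 2).

(** The weight for which the [p]-th power of the norm of the [t]-th difference is
    comparable to [2^-t], whatever the level [a]. *)
Definition peak_weight t a : R :=
  ((2^-1) ^+ t * (M m a)%:R `^ (1 - p)) `^ p^-1.

Lemma peak_weight_ge0 t a : 0 <= peak_weight t a.
Proof. exact: powR_ge0. Qed.

Lemma peak_weight_powR_le t a :
  (peak_weight t a * (M m a.+1)%:R) `^ p / (M m a)%:R <= (2^-1) ^+ t * B%:R `^ p.
Proof.
have M0 := MR_gt0 R hm a.
rewrite powRM ?powR_ge0// -powRrM mulVf ?gt_eqF//.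
rewrite powRr1 ?mulr_ge0 ?exprn_ge0 ?powR_ge0 ?invr_ge0//.
rewrite /= natrM powRM// -!mulrA ler_wpM2l ?exprn_ge0 ?invr_ge0//.
rewrite mulrCA -[leRHS]mulr1 ler_pM ?mulr_ge0 ?powR_ge0 ?invr_ge0//.
  by rewrite ge0_ler_powR ?nnegrE ?ler_nat// ltW.
rewrite mulrA -powRD; last by rewrite (gt_eqF M0) implybT.
by rewrite subrK powRr1// divff// gt_eqF.
Qed.

Lemma in_hardy_peaks alpha : (forall t, (alpha t < alpha t.+1)%N) ->
  in_hardy mu p (block_martingale (extend0 alpha (fun t => peak_weight t (alpha t)))).
Proof.
move=> alphaS; set w := extend0 _ _.
have w0 j : 0 <= w j by apply: extend0_ge0 => t; exact: peak_weight_ge0.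
have p1 : p <= 1 by have := p_half; lra.
apply: (@in_hardy_block _ _ hm _ mu_product w p (2 * B%:R `^ p)) => // n.
pose u j := (w j * (M m j.+1)%:R) `^ p / (M m j)%:R.
have u0 j : 0 <= u j by rewrite divr_ge0// powR_ge0.
apply: (@le_trans _ _ (\sum_(j < alpha n) u j)).
  rewrite -!(big_mkord xpredT u) [leRHS](@big_cat_nat _ _ _ n)//=.
    by rewrite lerDl sumr_ge0.
  exact: leq_lacunary.
rewrite (sum_lacunary alphaS) => [|j jalpha]; last first.
  by rewrite /u /w extend0_out// mul0r powR0 ?gt_eqF// mul0r.
apply: (@le_trans _ _ (\sum_(i < n) (2^-1) ^+ i * B%:R `^ p)).
  by apply: ler_sum => i _; rewrite /u /w extend0_in// peak_weight_powR_le.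
rewrite -mulr_suml ler_wpM2r ?powR_ge0//.
have : (2^-1 - 1) * \sum_(i < n) 2^-1 ^+ i = 2^-1 ^+ n - 1 :> R by rewrite -subrX1.
have : 0 <= 2^-1 ^+ n :> R by rewrite exprn_ge0 ?invr_ge0.
lra.
Qed.

(** The choice of [b] makes the contribution [C] of the lower levels at most half
    of the main term. *)
Lemma riesz_maximal_powR_ge w t b s C (x : vilenkin m) :
  (forall j, 0 <= w j) -> w (2 * b)%N = peak_weight t (2 * b) ->
  \sum_(j < 2 * b) w j * (M m j.+1)%:R <= C -> 0 <= C ->
  C `^ p <= peak_mass p B t b * b%:R ->
  (0 < b)%N -> (b <= s < b + b)%N -> cylinder s (origin m) x ->
  ((peak_mass p B t b * (M m s)%:R)%:E <=
    `|riesz_maximal mu (block_martingale w) x| `^ p)%E.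
Proof.
move=> w0 wE wC C0 bC b0 /andP[bs sb] xs.
have sa : (s < 2 * b)%N by rewrite mul2n -addnn.
have B0 : 0 < B%:R :> R by rewrite ltr0n (leq_trans _ (mB 0))// ltnW.
have M0 n : 0 < (M m n)%:R :> R by exact: MR_gt0.
pose D : R := 16 * B%:R * (2 * b)%:R.
have D0 : 0 < D by rewrite !mulr_gt0// ltr0n muln_gt0.
pose X := peak_weight t (2 * b) * (M m s)%:R ^+ 2 / (D * (M m (2 * b))%:R).
have X0 : 0 <= X.
  by rewrite !(mulr_ge0, exprn_ge0, invr_ge0) ?peak_weight_ge0// ltW.
have XR : ((2 * X - C)%:E <= riesz_maximal mu (block_martingale w) x)%E.
  apply: le_trans (riesz_maximal_ge hm mu_product w0 mB sa xs wC).
  rewrite lee_fin wE /X /D natrM le_eqVlt; apply/orP; left; apply/eqP.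
  by congr (_ - _); field; rewrite !gt_eqF// ltr0n.
have massX : peak_mass p B t b * (M m s)%:R <= X `^ p.
  apply: peak_height_ge => //.
  - by rewrite ler1n M_gt0.
  - by rewrite ler_nat leq_M// ltnW.
have CX : C <= X.
  rewrite leNgt; apply/negP => /(gt0_ltr_powR p0); rewrite !nnegrE => /(_ X0 C0).
  apply/negP; rewrite -leNgt; apply: le_trans bC _; apply: le_trans massX.
  rewrite ler_wpM2l ?peak_mass_ge0// ler_nat (leq_trans (ltnW (ltn_M hm b)))//.
  exact: leq_M.
apply: (@le_trans _ _ (X%:E `^ p)%E); first by rewrite poweR_EFin lee_fin.
apply: gt0_ler_poweR; rewrite ?in_itv/= ?leey ?andbT ?abse_ge0 ?lee_fin ?(ltW p0)//.
apply: le_trans (lee_abs _); apply: le_trans XR; rewrite lee_fin; lra.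
Qed.

End Peaks.

Theorem theorem2 (R : realType) (m : nat -> nat)
    (m_ge2 : forall k, (2 <= m k)%N)
    (m_bounded : exists B : nat, forall k, (m k <= B)%N)
    (mu : {measure set (vilenkin m) -> \bar R})
    (mu_product : is_product_measure mu)
    (p : R) (p_gt0 : 0 < p) (p_le_half : p <= 1 / 2) :
  exists f : nat -> vilenkin m -> R[i],
    in_hardy mu p f /\ Lnorm mu p%:E (riesz_maximal mu f) = +oo%E.
Proof.
have [B mB] := m_bounded.
have B0 : (0 < B)%N by rewrite (leq_trans _ (mB 0%N))// ltnW.
pose v t a := peak_weight m p t a * (Defs.M m a.+1)%:R.
pose peak_level t (C : R) a := exists b,
  [/\ (0 < b)%N, a = (2 * b)%N, C `^ p <= peak_mass p B t b * b%:R &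
      t%:R <= peak_mass p B t b * b%:R / 2].
have [alpha alphaS alphaP] : exists2 alpha : nat -> nat,
    (forall t, (alpha t < alpha t.+1)%N) &
    forall t, peak_level t (\sum_(i < t) v i (alpha i)) (alpha t).
  apply: lacunary_choice => [t a|t C l C0].
    by rewrite mulr_ge0// peak_weight_ge0.
  have [b [b0 lb bC bt]] := peak_level_exists p_le_half t l B0 C0.
  by exists (2 * b)%N; [rewrite (leq_trans lb)// leq_pmull|exists b].
pose w := extend0 alpha (fun t => peak_weight m p t (alpha t)).
exists (block_martingale w); split; first exact: (in_hardy_peaks m_ge2 mB).
rewrite unlock (_ : \int[mu]_x _ = +oo)%E;
  first by rewrite poweRyr// invr_eq0 gt_eqF.
have w0 j : 0 <= w j by apply: extend0_ge0 => t; exact: peak_weight_ge0.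
have wE t : w (alpha t) = peak_weight m p t (alpha t) by exact: (extend0_in alphaS).
(* The [t]-th peak alone makes the integral at least [t]. *)
apply/eqyP => r r0; pose t := Num.bound r.
have [b [b0 ab bC bt]] := alphaP t.
apply: (@le_trans _ _ t%:R%:E).
  by rewrite lee_fin; apply/ltW/archi_boundP/ltW.
apply: (@le_trans _ _ (peak_mass p B t b * b%:R / 2)%:E); first by rewrite lee_fin.
apply: (@integral_cylinder_ge _ _ m_ge2 _ mu_product _ b b); first exact: peak_mass_ge0.
  by move=> x; exact: poweR_ge0.
move=> s x bs xs; apply: (riesz_maximal_powR_ge m_ge2 mB mu_product p_gt0 p_le_half
  w0 _ _ _ bC b0 bs xs).
- by rewrite -ab wE.
- rewrite -ab (sum_lacunary alphaS (G := fun j => w j * (Defs.M m j.+1)%:R)).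
    by apply: ler_sum => i _; rewrite wE.
  by move=> j jalpha; rewrite /w extend0_out// mul0r.
- by apply: sumr_ge0 => i _; rewrite mulr_ge0 ?peak_weight_ge0.
Qed.
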